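(* Suppose that either (a) $r\ge0$ and $s=1$, or (b) $r\ge1$ and $s>1$. Let $\boldsymbol{\pi}(r,s)$ be the free Bessel law with parameters $r,s$ and let $\mathrm{DH}_r$ be the Dykema–Haagerup distribution (both defined in the context). Then $$\mathbf{D}_{t^r}\!\left(\left(\boldsymbol{\pi}(r,s)^{\boxtimes t}\right)^{1/t}\right)\longrightarrow \mathrm{DH}_r\quad\text{weakly as } t\downarrow0 .$$
   Context: For a probability measure $\mu\ne\delta_0$ on $[0,\infty)$ let $F_\mu=1/G_\mu$ with $G_\mu(z)=\int\frac{\mu(dx)}{z-x}$, $\eta_\mu(z)=1-zF_\mu(1/z)$, and $\Sigma_\mu(z)=\eta_\mu^{-1}(z)/z$ for $1-1/\mu(\{0\})<z<0$ (inverse of the strictly increasing function $\eta_\mu|_{(-\infty,0)}$). Multiplicative free convolution $\boxtimes$ on $[0,\infty)$ satisfies $\Sigma_{\mu\boxtimes\nu}=\Sigma_\mu\Sigma_\nu$ on some interval $(-c,0)$. If $\mu$ on $(0,\infty)$ is $\boxtimes$-infinitely divisible (has an $n$-th $\boxtimes$-convolution root for every $n$), $\mu^{\boxtimes t}$ for $t\ge0$ is the unique probability measure on $(0,\infty)$ with $\Sigma_{\mu^{\boxtimes t}}=\Sigma_\mu^t$ on $(-\infty,0)$. For a measure $\nu$ on $(0,\infty)$ and $p\in\mathbb{R}$, $\nu^p$ is the push-forward of $\nu$ by $x\mapsto x^p$; $\mathbf{D}_s(\nu)$ is the push-forward of $\nu$ by $x\mapsto sx$. Let $\boldsymbol{\pi}$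 be the free Poisson (Marchenko–Pastur) law, with $\Sigma_{\boldsymbol\pi}(z)=1-z$. In the parameter ranges considered, the free Bessel law is $\boldsymbol{\pi}(r,s)=\boldsymbol{\pi}^{\boxtimes(r-1)}\boxtimes\boldsymbol{\pi}^{\boxplus s}$ for $r\ge1$, $s\geq 1$ (where $\boxplus s$ is the additive free convolution power), and $\boldsymbol{\pi}(r,1)=\boldsymbol{\pi}^{\boxtimes r}$ for $r\ge0$; its $\Sigma$-transform is $\Sigma_{\boldsymbol{\pi}(r,s)}(z)=\frac{(1-z)^r}{(1-s)z+s}$, $z<0$. These laws are $\boxtimes$-infinitely divisible on $(0,\infty)$ for the stated ranges. For $r\ge0$, the Dykema–Haagerup distribution $\mathrm{DH}_r$ is the (compactly supported) probability measure on $[0,\infty)$ with moments $\int x^n\,\mathrm{DH}_r(dx)=\frac{n^{rn}}{\Gamma(2+rn)}$, $n=0,1,2,\dots$, with the convention $0^0=1$. *)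

(* Defs.v *)
From HB Require Import structures.
From mathcomp Require Import all_boot all_order all_algebra.
From mathcomp Require Import all_classical all_reals all_analysis measurable_realfun.

Set Implicit Arguments.
Unset Strict Implicit.
Unset Printing Implicit Defensive.

Import Order.TTheory GRing.Theory Num.Theory.
Import numFieldNormedType.Exports.

Local Open Scope classical_set_scope.
Local Open Scope ring_scope.

(* All laws are Borel probability measures on R; a law on (0, oo) or [0, oo)
   is one giving that interval mass 1. *)
Notation law R := (probability (measurableTypeR R) R).

Section transforms.
Context {R : realType}.
Implicit Type mu : law R.

(* The transforms of a law on [0, oo) are only ever needed on the negative
   half-line, where they are real-valued: G_mu is an integral of the bounded
   function x |-> 1 / (z - x), and G_mu(z) < 0. *)
Definition Cauchy_transform mu (z : R) : R := \int[mu]_x (z - x)^-1.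

Definition F_transform mu (z : R) : R := (Cauchy_transform mu z)^-1.

Definition eta_transform mu (z : R) : R := 1 - z * F_transform mu z^-1.

(* Both pinv_ below invert a function on (-oo, 0) and are meaningful only on
   its range: (1 - 1 / mu {0}, 0) for eta_mu (that is (-oo, 0) if mu is
   carried by (0, oo)), and an interval (-e, 0) for G_mu. *)
Definition Sigma_transform mu (z : R) : R :=
  'pinv_(fun=> 0) `]-oo, 0[ (eta_transform mu) z / z.

Definition R_transform mu (w : R) : R :=
  'pinv_(fun=> 0) `]-oo, 0[ (Cauchy_transform mu) w - w^-1.

End transforms.

Section free_convolutions.
Context {R : realType}.
Implicit Types (mu nu rho : law R) (s t : R).

Definition on_pos mu := mu `]0, +oo[%classic = 1%E.

Definition on_nneg mu := mu `[0, +oo[%classic = 1%E.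

Definition on_nneg_neq0 mu := on_nneg mu /\ mu [set 0] <> 1%E.

(* The free convolutions and their powers are given as relations, by the
   equation between transforms that characterizes the resulting law.
   Below, rho is the multiplicative free convolution of mu and nu. *)
Definition is_free_mul mu nu rho :=
  [/\ on_nneg_neq0 mu, on_nneg_neq0 nu, on_nneg_neq0 rho &
      exists2 c : R, 0 < c & {in `]- c, 0[, forall z,
        Sigma_transform rho z = Sigma_transform mu z * Sigma_transform nu z}].

(* nu is the t-th multiplicative free convolution power of mu, t >= 0 *)
Definition is_free_mul_power mu t nu :=
  [/\ on_pos mu, on_pos nu &
      forall z : R, z < 0 -> Sigma_transform nu z = Sigma_transform mu z `^ t].

(* nu is the s-th additive free convolution power of mu, s >= 1; the powers
   s >= 1 of a law on [0, oo) are again laws on [0, oo), so the linearization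
   R_nu = s R_mu can be read on the negative half-line. *)
Definition is_free_add_power mu s nu :=
  [/\ on_nneg mu, on_nneg nu &
      exists2 e : R, 0 < e & {in `]- e, 0[, forall w,
        R_transform nu w = s * R_transform mu w}].

End free_convolutions.

Section laws.
Context {R : realType}.
Implicit Types (mu p : law R) (r s : R).

Definition free_poisson_density (x : R) : R :=
  Num.sqrt (x * (4 - x)) / (2 * pi * x).

Definition is_free_poisson p := forall A, measurable A ->
  p A = (\int[lebesgue_measure]_(x in A `&` `]0%R, 4%R[)
           (free_poisson_density x)%:E)%E.

Variant is_free_bessel r s mu : Prop :=
| FreeBessel_one p of 0 <= r & s = 1 & is_free_poisson p &
    is_free_mul_power p r mu
| FreeBessel_ge1 p p1 p2 of 1 <= r & 1 <= s & is_free_poisson p &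
    is_free_mul_power p (r - 1) p1 & is_free_add_power p s p2 &
    is_free_mul p1 p2 mu.

Definition Gamma (x : R) : R :=
  \int[lebesgue_measure]_(y in `]0, +oo[) (y `^ (x - 1) * expR (- y)).

(* for n = 0 the numerator is 0 `^ 0 = 1 *)
Definition is_Dykema_Haagerup r mu :=
  (exists M : R, mu `[0, M]%classic = 1%E) /\
  forall n : nat,
    (\int[mu]_x (x ^+ n)%:E = (n%:R `^ (r * n%:R) / Gamma (2 + r * n%:R))%:E)%E.

End laws.

Section push_forward.
Context {R : realType}.
Implicit Types (mu : law R) (p s : R).

Definition power_fun p (x : measurableTypeR R) : measurableTypeR R := x `^ p.

Definition scale_fun s (x : measurableTypeR R) : measurableTypeR R := s * x.

Lemma measurable_power_fun p : measurable_fun setT (power_fun p).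
Proof. exact: measurable_powR. Qed.

Lemma measurable_scale_fun s : measurable_fun setT (scale_fun s).
Proof. exact: mulrl_measurable. Qed.

HB.instance Definition _ p :=
  isMeasurableFun.Build _ _ _ _ (power_fun p) (measurable_power_fun p).
HB.instance Definition _ s :=
  isMeasurableFun.Build _ _ _ _ (scale_fun s) (measurable_scale_fun s).

(* nu^p; for nu on (0, oo) the values of x `^ p at x <= 0 are immaterial *)
Definition law_power mu p : law R := distribution mu (power_fun p).

Definition dilation s mu : law R := distribution mu (scale_fun s).

End push_forward.

Definition weakly_cvg {R : realType} {T : Type} (F : set_system T)
    (mu : T -> law R) (nu : law R) :=
  forall f : R -> R, continuous f -> bounded_fun f ->
    (\int[mu t]_x f x) @[t --> F] --> \int[nu]_x f x.

(* Main.v *)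
Require Import Defs.
From mathcomp Require Import all_boot all_order all_algebra.
From mathcomp Require Import all_classical all_reals all_analysis.
From mathcomp Require Import measurable_realfun.
From mathcomp Require Import ring lra.
Import Order.TTheory GRing.Theory Num.Theory.
Import numFieldNormedType.Exports.
Set Implicit Arguments.
Unset Strict Implicit.
Unset Printing Implicit Defensive.
Local Open Scope classical_set_scope.
Local Open Scope ring_scope.

(** The proof is a method of moments, fed by a closed formula for the moments
    of [mu^{boxtimes t}].

    Write [Sigma(w) = (1-w)^r / (s-(s-1)w)] for the Sigma-transform of the free
    Bessel law [mu] (lemma [Sigma_free_bessel]).  For a law carried by [0,oo)
    put [A(z) = int 1/(1-zx)], so that [eta = 1 - 1/A].  That [Sigma^t] is the
    Sigma-transform of [mu^{boxtimes t}] means [A(w Sigma(w)^t) = 1/(1-w)] for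
    [w < 0].  Since [A] generates the moments [m_k] of [mu^{boxtimes t}],
    Lagrange inversion yields, for k >= 1,
      [m_k = (1/k) [w^(k-1)] (1-w)^(-2) Sigma(w)^(-kt)]
    (lemmas [Lagrange_inversion], [moments_of_Sigma]).  Everything takes place
    on the negative half-line, so power series are replaced by polynomials that
    approximate a function up to O(|w|^N) when w increases to 0; the finiteness
    of the moments is itself read off such an expansion of [A], by Fatou.

    Let [X] have law [mu^{boxtimes t}] and let [Y = t^r X^(1/t)], whose law must
    converge.  Given an integer n, take k = floor(n/t) and u = kt, so that
    n-t <= u <= n.  Then [E Y^u = t^(ru) m_k], and in the formula for [m_k] the
    exponent kt = u of Sigma stays bounded while the index k-1 of the
    coefficient tends to infinity: singularity analysis applies.  From
      [(s-(s-1)w)^u = (1+(s-1)(1-w))^n (s-(s-1)w)^(-(n-u))]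
    one sees that the dominant singularity is [(1-w)^(-(2+ru))], with weight
    tending to 1: expanding the first factor only adds smaller exponents, and
    the second one is s^(u-n) at w = 0, equals 1 at w = 1, and has nonnegative
    coefficients.  Hence [k m_k] is asymptotic to
    [Gamma(k+1+ru) / (Gamma(2+ru) (k-1)!)], and
    [E Y^u --> n^(rn) / Gamma(2+rn)] (lemmas [bessel_coef_bounds],
    [cvg_scaled_bessel_moment]).  The passage from the exponent u to n costs
    o(1), by the Bernoulli inequality (lemma [cvg_root_moments]).

    So all the moments converge to those of the Dykema-Haagerup law.  The latter
    is compactly supported, hence polynomial approximation upgrades this to weak
    convergence (lemma [weakly_cvg_of_moments]). *)

(** * Truncated series and Lagrange inversion *)

Section TruncatedSeries.
Context {R : numFieldType}.
Implicit Types (p q : {poly R}) (n : nat).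

Definition eq_modXn n p q := exists r, p = q + r * 'X^n.

Lemma eq_modXn_refl n p : eq_modXn n p p.
Proof. by exists 0; rewrite mul0r addr0. Qed.

Lemma eq_modXn_trans {n p q p'} :
  eq_modXn n p q -> eq_modXn n q p' -> eq_modXn n p p'.
Proof. by move=> [r ->] [r' ->]; exists (r + r'); ring. Qed.

Lemma eq_modXn_mul {n p q p' q'} :
  eq_modXn n p q -> eq_modXn n p' q' -> eq_modXn n (p * p') (q * q').
Proof.
move=> [r ->] [r' ->]; exists (q * r' + r * q' + r * r' * 'X^n); ring.
Qed.

Lemma eq_modXn_exp {n p q} k : eq_modXn n p q -> eq_modXn n (p ^+ k) (q ^+ k).
Proof.
move=> pq; elim: k => [|k IH]; first by rewrite !expr0; exact: eq_modXn_refl.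
by rewrite !exprS; exact: eq_modXn_mul.
Qed.

Lemma eq_modXn_coef {n p q} i : eq_modXn n p q -> (i < n)%N -> p`_i = q`_i.
Proof. by move=> [r ->] ilt; rewrite coefD coefMXn ilt addr0. Qed.

Lemma coef_eq_modXn n p q : (forall i, (i < n)%N -> p`_i = q`_i) ->
  eq_modXn n p q.
Proof.
move=> pq; exists (drop_poly n (p - q)).
have : take_poly n (p - q) = 0.
  apply/polyP => i; rewrite coef_take_poly coef0; case: ifP => // ilt.
  by rewrite coefB pq// subrr.
by move=> t0; rewrite -[in LHS](subrK q p) -[in LHS](poly_take_drop n (p - q))
  t0 add0r addrC.
Qed.

Lemma eq_modXn_deriv {n p q} : eq_modXn n.+1 p q -> eq_modXn n p^`() q^`().
Proof.
move=> [r ->]; exists (r^`() * 'X + r *+ n.+1).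
rewrite derivD derivM derivXn exprS/= !mulrnAr mulrDl mulrnAl; ring.
Qed.

(** The powers of a series of order one form a triangular system, so that any
    series can be expanded along them. *)
Lemma powers_modXn_basis p h : p`_0 != 0 -> forall n, exists c : nat -> R,
  eq_modXn n h (\sum_(j < n) c j *: ('X * p) ^+ j).
Proof.
move=> p0; elim=> [|n [c [r hE]]].
  by exists (fun=> 0); rewrite big_ord0; exists h; rewrite expr0; ring.
pose a := r`_0 / p`_0 ^+ n.
exists (fun j => if (j < n)%N then c j else a).
rewrite big_ord_recr/= ltnn.
under eq_bigr do rewrite ltn_ord.
have /coef_eq_modXn[r' r'E] : forall i, (i < 1)%N -> (r - a *: p ^+ n)`_i = (0 : {poly R})`_i.
  case=> // _; rewrite coefB coefZ coef0.
  have -> : (p ^+ n)`_0 = p`_0 ^+ n by rewrite -!horner_coef0 horner_exp.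
  by rewrite /a divfK ?subrr// expf_neq0.
exists r'; rewrite add0r expr1 in r'E.
rewrite hE -addrA; congr (_ + _).
rewrite exprMn exprS mulrA.
have -> : r = r' * 'X + a *: p ^+ n by rewrite -r'E subrK.
rewrite mulrDl -!scalerAl -(mulrC 'X^n) addrC; congr (_ + _).
by rewrite (mulrC _ 'X^n).
Qed.

(** With [chi = X p], [chi^(j-1) chi' / chi^k] has residue 1 for j = k and is a
    derivative otherwise; multiplying by X^k and writing q for 1/p turns this
    into a statement on coefficients of polynomials, valid modulo X^N. *)
Lemma residue_derivative p q N j k : eq_modXn N (p * q) 1 ->
  (0 < j <= N)%N -> (0 < k <= N)%N ->
  (('X * p) ^+ j.-1 * ('X * p)^`() * q ^+ k)`_k.-1 = (j == k)%:R.
Proof.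
move=> pq /andP[j0 jN] /andP[k0 kN].
have N0 : (0 < N)%N by exact: leq_trans kN.
case: j j0 jN => //= j _ jN; case: k k0 kN => //= k _ kN.
rewrite eqSS derivM derivX mul1r.
have -> : ('X * p) ^+ j * (p + 'X * p^`()) * q ^+ k.+1 =
   (p ^+ j * (p + 'X * p^`()) * q ^+ k.+1) * 'X^j.
  by rewrite exprMn; ring.
rewrite coefMXn; case: ltnP => [kj|jk]; first by rewrite gtn_eqF.
have [m kE] : exists m, k = (j + m)%N by exists (k - j)%N; rewrite subnKC.
have km : (m < N)%N by apply: leq_ltn_trans kN; rewrite kE leq_addl.
have -> : (j == k) = (0%N == m) by rewrite kE -{1}(addn0 j) eqn_add2l.
rewrite {}kE addKn.
have -> : p ^+ j * (p + 'X * p^`()) * q ^+ (j + m).+1 =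
  (p * q) ^+ j.+1 * q ^+ m + ((p * q) ^+ j * (p^`() * q ^+ m.+1)) * 'X.
  rewrite -addnS !exprMn exprD !exprS; ring.
rewrite coefD coefMX.
have E1 : ((p * q) ^+ j.+1 * q ^+ m)`_m = (q ^+ m)`_m.
  apply: eq_modXn_coef km.
  have := eq_modXn_mul (eq_modXn_exp j.+1 pq) (eq_modXn_refl N (q ^+ m)).
  by rewrite expr1n mul1r.
rewrite E1; case: m km {E1} => [_|m mN]; first by rewrite expr0 coef1 addr0.
rewrite /=.
have -> : ((p * q) ^+ j * (p^`() * q ^+ m.+2))`_m = (- (q^`() * q ^+ m))`_m.
  case: N pq {N0 jN kN} mN => // N pq mN.
  apply: (@eq_modXn_coef N); last exact: mN.
  have pqN : eq_modXn N (p * q) 1.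
    by case: pq => r ->; exists (r * 'X); rewrite exprS; ring.
  have /eq_modXn_deriv := pq; rewrite derivM derivC => -[r rE].
  have := eq_modXn_mul (eq_modXn_exp j pqN) (eq_modXn_refl N (p^`() * q ^+ m.+2)).
  rewrite expr1n mul1r => /eq_modXn_trans; apply.
  apply: (@eq_modXn_trans _ _ (- (p * q) * (q^`() * q ^+ m))).
    exists (r * q ^+ m.+1).
    have -> : p^`() * q ^+ m.+2 = (p^`() * q + p * q^`()) * q ^+ m.+1 - (p * q) * (q^`() * q ^+ m).
      by rewrite !exprS; ring.
    by rewrite rE; ring.
  have := eq_modXn_mul (eq_modXn_mul (eq_modXn_refl N (-1)) pqN) (eq_modXn_refl N (q^`() * q ^+ m)).
  by rewrite mulN1r mulr1 mulN1r.
have := coef_deriv (q ^+ m.+1) m.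
rewrite deriv_exp/= coefMn => /(pmulrnI (ltn0Sn m)) <-.
by rewrite coefN subrr.
Qed.

(** Lagrange inversion: differentiating [h = sum_j c_j (X p)^j] and taking the
    residue against [(X p)^(-k)] isolates [k c_k]. *)
Lemma Lagrange_inversion p q h (c : nat -> R) N : eq_modXn N (p * q) 1 ->
  eq_modXn N.+1 h (\sum_(j < N.+1) c j *: ('X * p) ^+ j) ->
  forall k, (0 < k <= N)%N -> c k *+ k = (h^`() * q ^+ k)`_k.-1.
Proof.
move=> pq /eq_modXn_deriv hE k /andP[k0 kN].
rewrite (eq_modXn_coef (i := k.-1) (eq_modXn_mul hE (eq_modXn_refl N (q ^+ k))));
  last by rewrite prednK.
rewrite (raddf_sum (@deriv R)) mulr_suml coef_sum.
rewrite big_ord_recl/= derivZ expr0 derivC scaler0 mul0r coef0 add0r.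
case: k k0 kN => //= k _ kN.
have T (i : 'I_N) :
    ((c (bump 0 i) *: ('X * p) ^+ bump 0 i)^`() * q ^+ k.+1)`_k =
    c i.+1 * ((i == k :> nat)%:R *+ i.+1).
  rewrite /bump add1n derivZ deriv_exp -!scalerAl coefZ mulrnAl coefMn.
  rewrite (mulrC (_ ^`())); congr (_ * (_ *+ _)).
  by rewrite (residue_derivative (j := i.+1) (k := k.+1) pq) ?ltn_ord ?eqSS.
under eq_bigr do rewrite T.
rewrite (bigD1 (Ordinal kN))//= big1 => [|i ik]; last first.
  by rewrite -val_eqE/= in ik; rewrite (negbTE ik) mul0rn mulr0.
by rewrite eqxx addr0 mulrnAr mulr1.
Qed.
End TruncatedSeries.

(** * Polynomial expansions at 0 from the left *)

Section Binomial.
Context {R : realType}.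
Implicit Types (f g : R -> R) (p q : {poly R}) (N : nat) (a c w : R).

Lemma MVT_is_derive f df (a b : R) : a <= b ->
  (forall x, a <= x <= b -> is_derive x 1 f (df x)) ->
  exists2 x, a <= x <= b & f b - f a = df x * (b - a).
Proof.
move=> ab dfx; have [||x] := @MVT_segment R f df a b ab.
- by move=> x xab; apply: dfx; rewrite !ltW ?(itvP xab).
- apply: derivable_within_continuous => x; rewrite in_itv/= => /dfx dx.
  exact: ex_derive.
by rewrite in_itv/= => xab ?; exists x.
Qed.

(** The coefficient of w^i in [(1-w)^(-a)], that is a(a+1)...(a+i-1)/i!. *)
Definition binom_coef a (i : nat) := \prod_(j < i) ((a + j%:R) / j.+1%:R).

Lemma binom_coefS a i :
  binom_coef a i.+1 = binom_coef a i * ((a + i%:R) / i.+1%:R).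
Proof. by rewrite /binom_coef big_ord_recr. Qed.

Lemma binom_coef0 a : binom_coef a 0 = 1.
Proof. by rewrite /binom_coef big_ord0. Qed.

Lemma binom_coef_ge0 a i : 0 <= a -> 0 <= binom_coef a i.
Proof.
by move=> a0; apply: prodr_ge0 => j _; rewrite divr_ge0// addr_ge0.
Qed.

Lemma binom_coef_deriv a i :
  binom_coef a i.+1 * i.+1%:R = a * binom_coef (a + 1) i.
Proof.
elim: i => [|i IH]; first by rewrite binom_coefS !binom_coef0 addr0 divr1; ring.
rewrite binom_coefS -mulrA divfK ?pnatr_eq0//.
have -> : binom_coef a i.+1 = a * binom_coef (a + 1) i / i.+1%:R.
  by rewrite -IH mulfK ?pnatr_eq0.
rewrite binom_coefS -(natr1 i); ring.
Qed.

Definition binom_poly a c N := \poly_(i < N) (binom_coef a i * c ^+ i).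

Definition binom_rem a c N w := (1 - c * w) `^ (- a) - (binom_poly a c N).[w].

Lemma binom_rem0 a c N : binom_rem a c N.+1 0 = 0.
Proof.
rewrite /binom_rem mulr0 subr0 powR1 horner_coef0 coef_poly/=.
by rewrite binom_coef0 expr0 mulr1 subrr.
Qed.

Lemma deriv_binom_poly a c N :
  (binom_poly a c N.+1)^`() = (a * c) *: binom_poly (a + 1) c N.
Proof.
apply/polyP => i; rewrite coef_deriv coefZ !coef_poly ltnS.
case: ifPn; rewrite ?mul0rn ?mulr0// => _.
by rewrite -mulr_natr exprS mulrAC binom_coef_deriv; ring.
Qed.

Lemma is_derive_binom_rem a c N w : 0 < 1 - c * w ->
  is_derive w 1 (binom_rem a c N.+1) (a * c * binom_rem (a + 1) c N w).
Proof.
move=> cw.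
have D1 : is_derive w 1 (fun w : R => (1 - c * w)) (- c).
  apply: is_derive_eq.
  by rewrite add0r mul1r; congr (- _); exact: mulr1.
have D2 := @is_derive1_comp R (@powR R ^~ (- a)) (fun w : R => 1 - c * w) w _ _
  (is_derive1_powR (- a) cw) D1.
have D3 := is_derive_poly (binom_poly a c N.+1) w.
apply: (is_derive_eq (is_deriveB D2 D3)).
rewrite deriv_binom_poly hornerZ /binom_rem opprD; ring.
Qed.

(** For a, c >= 0 all derivatives of [(1-cw)^(-a)] are nonnegative, so the Taylor
    polynomials at 0 are lower bounds on the positive side. *)
Lemma binom_poly_le a c N w : 0 <= a -> 0 <= c -> 0 <= w -> c * w < 1 ->
  (binom_poly a c N).[w] <= (1 - c * w) `^ (- a).
Proof.
suff H : 0 <= a -> 0 <= c -> 0 <= w -> c * w < 1 -> 0 <= binom_rem a c N w.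
  by move=> a0 c0 w0 cw; rewrite -subr_ge0; exact: H.
elim: N a w => [|N IH] a w a0 c0 w0 cw.
  rewrite /binom_rem/binom_poly (_ : \poly_(i < 0) _ = 0) ?horner0 ?subr0 ?powR_ge0//.
  by apply/polyP => i; rewrite coef_poly coef0.
have [x|x /andP[x0 xw]] := @MVT_is_derive (binom_rem a c N.+1)
  (fun x => a * c * binom_rem (a + 1) c N x) 0 w w0.
  move=> /andP[x0 xw]; apply: is_derive_binom_rem.
  by rewrite subr_gt0 (le_lt_trans _ cw)// ler_wpM2l.
rewrite binom_rem0 !subr0 => ->.
rewrite !mulr_ge0// IH// ?addr_ge0//.
by rewrite (le_lt_trans _ cw)// ler_wpM2l.
Qed.

(** Taylor estimate, by induction on N: the derivative of the remainder of
    order N+1 is a multiple of the remainder of order N for the exponent a+1. *)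
Lemma binom_rem_bound a c N : 0 <= c ->
  exists2 C, 0 <= C & forall w, -1 <= w <= 0 ->
    `|binom_rem a c N w| <= C * `|w| ^+ N.
Proof.
move=> c0; elim: N a => [|N IH] a.
  exists ((1 + c) `^ `|a|); first exact: powR_ge0.
  move=> w /andP[w1 w0]; rewrite expr0 mulr1.
  rewrite /binom_rem/binom_poly (_ : \poly_(i < 0) _ = 0); last first.
    by apply/polyP => i; rewrite coef_poly coef0.
  rewrite horner0 subr0 ger0_norm ?powR_ge0//.
  have cw : 1 <= 1 - c * w by rewrite lerDl oppr_ge0 mulr_ge0_le0.
  apply: (@le_trans _ _ ((1 - c * w) `^ `|a|)).
    by rewrite ler_powR// -normrN ler_norm.
  rewrite ge0_ler_powR ?nnegrE//; [lra|nra|nra].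
have [C C0 HC] := IH (a + 1).
exists (`|a * c| * C); first by rewrite mulr_ge0.
move=> w /andP[w1 w0].
have [x|x /andP[x0 xw]] := @MVT_is_derive (binom_rem a c N.+1)
  (fun x => a * c * binom_rem (a + 1) c N x) w 0 w0.
  move=> /andP[x0 xw]; apply: is_derive_binom_rem; nra.
rewrite binom_rem0 sub0r => /eqP; rewrite eqr_oppLR => /eqP ->.
rewrite normrN normrM sub0r normrN exprSr mulrA ler_wpM2r// normrM -mulrA.
rewrite ler_wpM2l// (le_trans (HC _ _))//; first lra.
by rewrite ler_wpM2l// lerXn2r ?nnegrE// !ler0_norm// lerN2.
Qed.

(** A one-sided substitute for power series: the transforms are only available
    on the negative half-line, where they need not be known to be analytic. *)
Definition expands f p N := exists C,
  \forall w \near 0^'-, `|f w - p.[w]| <= C * `|w| ^+ N.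

Lemma expands_binom a c N : 0 <= c ->
  expands (fun w => (1 - c * w) `^ (- a)) (binom_poly a c N) N.
Proof.
move=> c0; have [C C0 HC] := binom_rem_bound a N c0.
exists C; near=> w; apply: HC.
apply/andP; split; last by near: w; exact: nbhs_left_le.
by near: w; apply: nbhs_left_ge; rewrite ltrN10.
Unshelve. all: by end_near. Qed.

Lemma horner_bounded p : exists2 C, 0 <= C & forall w, `|w| <= 1 -> `|p.[w]| <= C.
Proof.
exists (\sum_(i < size p) `|p`_i|); first exact: sumr_ge0.
move=> w w1; rewrite horner_coef (le_trans (ler_norm_sum _ _ _))//.
apply: ler_sum => i _; rewrite normrM normrX ler_piMr// exprn_ile1//.
Qed.

Lemma near0N_norm : \forall w \near 0^'- , w < 0 /\ `|w| <= 1 :> R.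
Proof.
near=> w; have w0 : w < 0 by near: w; exact: nbhs_left_lt.
split=> //; rewrite ltr0_norm// lerNl; near: w; apply: nbhs_left_ge.
by rewrite ltrN10.
Unshelve. all: by end_near. Qed.

Lemma expands_poly p N : expands (horner p) p N.
Proof. by exists 0; near=> w; rewrite subrr normr0 mul0r. Unshelve. all: by end_near. Qed.

Lemma expandsD {f g p q N} : expands f p N -> expands g q N ->
  expands (fun w => f w + g w) (p + q) N.
Proof.
move=> [C HC] [D HD]; exists (C + D); near=> w.
rewrite hornerD opprD addrACA mulrDl.
apply: (le_trans (ler_normD _ _)); apply: lerD; near: w; exact: HC || exact: HD.
Unshelve. all: by end_near. Qed.

Lemma expandsM {f g p q N} : expands f p N -> expands g q N ->
  expands (fun w => f w * g w) (p * q) N.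
Proof.
move=> [C HC] [D HD].
have [Bp Bp0 HBp] := horner_bounded p; have [Bq Bq0 HBq] := horner_bounded q.
exists (`|C| * (`|D| + Bq) + Bp * `|D|); near=> w.
have [w0 w1] : w < 0 /\ `|w| <= 1 by near: w; exact: near0N_norm.
have fw : `|f w - p.[w]| <= `|C| * `|w| ^+ N.
  apply: (@le_trans _ _ (C * `|w| ^+ N)); first by near: w.
  by rewrite ler_wpM2r ?exprn_ge0// ler_norm.
have gw : `|g w - q.[w]| <= `|D| * `|w| ^+ N.
  apply: (@le_trans _ _ (D * `|w| ^+ N)); first by near: w.
  by rewrite ler_wpM2r ?exprn_ge0// ler_norm.
have wN : `|w| ^+ N <= 1 by rewrite exprn_ile1.
have gb : `|g w| <= `|D| + Bq.
  rewrite -[g w](subrK q.[w]) (le_trans (ler_normD _ _))//.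
  by rewrite lerD ?HBq// (le_trans gw)// ler_piMr.
rewrite hornerM.
have -> : f w * g w - p.[w] * q.[w] =
  (f w - p.[w]) * g w + p.[w] * (g w - q.[w]) by ring.
rewrite (le_trans (ler_normD _ _))// !normrM mulrDl lerD//.
  by rewrite mulrAC ler_pM.
by rewrite -mulrA ler_pM// HBp.
Unshelve. all: by end_near. Qed.

Lemma expands_exp {f p N} k : expands f p N ->
  expands (fun w => f w ^+ k) (p ^+ k) N.
Proof.
move=> fp; elim: k => [|k IH].
  have := expands_poly 1 N; congr (expands _ _ _).
  by apply/funext => w; rewrite hornerC.
by under eq_fun do rewrite exprS; rewrite exprS; exact: expandsM.
Qed.

Lemma expands_eq f g p N : (\forall w \near 0^'-, f w = g w) ->
  expands f p N -> expands g p N.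
Proof.
move=> fg [C HC]; exists C; near=> w.
by rewrite -(_ : f w = g w); near: w.
Unshelve. all: by end_near. Qed.

Lemma expandsZ {f p N} a : expands f p N ->
  expands (fun w => a * f w) (a *: p) N.
Proof.
move=> fp; rewrite -mul_polyC; apply: expandsM => //.
by apply: expands_eq (expands_poly a%:P N); apply: nearW => w; rewrite hornerC.
Qed.

Lemma expands_sum n (F : 'I_n -> R -> R) (P : 'I_n -> {poly R}) N :
  (forall i, expands (F i) (P i) N) ->
  expands (fun w => \sum_(i < n) F i w) (\sum_(i < n) P i) N.
Proof.
elim: n F P => [|n IH] F P FP.
  rewrite big_ord0; apply: expands_eq (expands_poly 0 N).
  by apply: nearW => w; rewrite big_ord0 horner0.
rewrite big_ord_recr/=.
have := expandsD (IH _ _ (fun i => FP (widen_ord (leqnSn n) i))) (FP ord_max).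
by apply: expands_eq; apply: nearW => w; rewrite big_ord_recr.
Qed.

Lemma expands_modXn {f p q N} : expands f p N -> eq_modXn N p q -> expands f q N.
Proof.
move=> [C HC] [r pE]; have [B B0 HB] := horner_bounded r.
exists (C + B); near=> w.
have [w0 w1] : w < 0 /\ `|w| <= 1 by near: w; exact: near0N_norm.
have -> : f w - q.[w] = (f w - p.[w]) + r.[w] * w ^+ N.
  by rewrite pE hornerD hornerM hornerXn; ring.
rewrite (le_trans (ler_normD _ _))// mulrDl lerD//; first by near: w.
by rewrite normrM normrX ler_wpM2r// HB.
Unshelve. all: by end_near. Qed.

Lemma small_poly_modXn p N C :
  (\forall w \near 0^'-, `|p.[w]| <= C * `|w| ^+ N) -> eq_modXn N p 0.
Proof.
elim: N p => [|N IH] p HC; first by exists p; rewrite expr0; ring.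
have p0 : p.[0] = 0.
  have H1 : p.[w] @[w --> 0^'-] --> p.[0].
    by apply: cvg_at_left_filter; exact: continuous_horner.
  have H2 : p.[w] @[w --> 0^'-] --> 0.
    apply/norm_cvg0P.
    apply: (@squeeze_cvgr _ _ _ _ (fun=> 0) (fun w => C * `|w| ^+ N.+1)).
    - by near=> w; rewrite normr_ge0/=; near: w.
    - exact: cvg_cst.
    - have : C * `|w| ^+ N.+1 @[w --> 0^'-] --> C * `|0 : R| ^+ N.+1.
        apply: cvg_at_left_filter; apply: cvgM; first exact: cvg_cst.
        apply: (@continuous_comp _ _ _ (fun w : R => `|w|) (fun x => x ^+ N.+1)).
          exact: norm_continuous.
        exact: exprn_continuous.
      by rewrite normr0 expr0n mulr0.
  exact: cvg_unique H1 H2.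
have /factor_theorem[q] : root p 0 by apply/eqP.
rewrite subr0 => pE.
have [r rE] : eq_modXn N q 0.
  apply: IH; near=> w.
  have [w0 w1] : w < 0 /\ `|w| <= 1 by near: w; exact: near0N_norm.
  have wgt0 : 0 < `|w| by rewrite normr_gt0 lt_eqF.
  rewrite -(ler_pM2r wgt0) -mulrA -exprSr -normrM.
  have -> : q.[w] * w = p.[w] by rewrite pE hornerM hornerX.
  by near: w.
by exists r; rewrite pE rE !add0r exprSr mulrA.
Unshelve. all: by end_near. Qed.

Lemma expands_unique {f p q N} : expands f p N -> expands f q N ->
  eq_modXn N p q.
Proof.
move=> fp fq; have [C HC] := expandsD fp (expandsZ (-1) fq).
rewrite scaleN1r in HC.
have [r rE] : eq_modXn N (p - q) 0.
  apply: (@small_poly_modXn _ _ C); near=> w.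
  rewrite -normrN -[- _]add0r -(subrr (f w)) -[f w - f w]/(f w + - f w).
  by rewrite -[- f w]mulN1r; near: w; exact: HC.
by exists r; rewrite -[p in LHS](subrK q) rE add0r addrC.
Unshelve. all: by end_near. Qed.

End Binomial.

(** * The transforms on the negative half-line *)

Lemma measurable_inv {R : realType} : measurable_fun setT (@GRing.inv R).
Proof.
have -> : @GRing.inv R = (fun x => x * (x ^+ 2) `^ (- 1)).
  apply/funext => x; rewrite powR_inv1 ?sqr_ge0//.
  have [->|x0] := eqVneq x 0; first by rewrite invr0 mul0r.
  by rewrite expr2 invfM mulrA divff// mul1r.
apply: measurable_funM => //.
apply: (measurableT_comp (measurable_powR (- 1))).
exact: measurable_funX.
Qed.

Section HalfLineLaws.
Context {R : realType}.
Implicit Types (mu : law R) (z : R).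

Lemma probability_eq1_subset mu (A B : set (measurableTypeR R)) :
  measurable A -> measurable B -> A `<=` B -> mu A = 1%E -> mu B = 1%E.
Proof.
move=> mA mB AB muA; apply/eqP; rewrite eq_le probability_le1//= -muA.
by apply: le_measure; rewrite ?inE.
Qed.

Lemma on_pos_nneg mu : on_pos mu -> on_nneg mu.
Proof.
by apply: probability_eq1_subset => //; apply: subset_itvr; rewrite bnd_simp.
Qed.

Lemma on_segment_nneg mu (M : R) : mu `[0, M]%classic = 1%E -> on_nneg mu.
Proof.
by apply: probability_eq1_subset => //; apply: subset_itvl; rewrite bnd_simp.
Qed.

Local Open Scope ereal_scope.
Lemma integral_carrier mu (D : set (measurableTypeR R)) (f : measurableTypeR R -> \bar R) :
  measurable D -> mu D = 1 ->
  measurable_fun setT f -> \int[mu]_x f x = \int[mu]_(x in D) f x.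
Proof.
move=> mD mu1 mf; rewrite [RHS]integral_mkcond; apply: ae_eq_integral => //.
  by apply/(measurable_restrictT _ mD); exact: measurable_funTS.
exists (~` D); split; first exact: measurableC.
  by have /= := probability_setC mu mD; rewrite mu1 subee.
move=> x /=; rewrite patchE; apply: contra_not => Dx _.
by rewrite mem_set.
Qed.

Local Close Scope ereal_scope.

(** The moment generating function of a law on [0,oo); it is the bounded
    quantity behind all the transforms: [eta = 1 - 1/A] and [G(1/z) = z A(z)]. *)
Definition eta_kernel mu z := (\int[mu]_(x in `[0%R, +oo[) (1 - z * x)^-1)%R.

Lemma measurable_eta_kernel z (D : set R) :
  measurable_fun D (fun x : measurableTypeR R => (1 - z * x)^-1 : R).
Proof.
apply: measurable_funTS; apply: (measurableT_comp measurable_inv).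
by apply: measurable_funB => //; exact: measurable_funM.
Qed.

Lemma eta_kernel_bound z x : z <= 0 -> 0 <= x -> 0 < (1 - z * x)^-1 <= 1.
Proof.
move=> z0 x0; have H : 1 <= 1 - z * x by nra.
by rewrite invr_gt0 (lt_le_trans ltr01 H)/= invf_le1 ?(lt_le_trans ltr01 H).
Qed.

Lemma integrable_bounded mu (D : set (measurableTypeR R)) (f : R -> R) C : measurable D ->
  measurable_fun D f -> (forall x, D x -> `|f x| <= C) ->
  mu.-integrable D (EFin \o f).
Proof.
move=> mD mf fC; apply: measurable_bounded_integrable => //.
  by rewrite (le_lt_trans (probability_le1 _ _))// ltry.
exists C; split; first exact: num_real.
by move=> M CM x Dx /=; rewrite (le_trans (fC _ Dx))// ltW.
Qed.

Lemma integrable_eta_kernel mu z : z <= 0 ->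
  mu.-integrable `[0%R, +oo[ (EFin \o (fun x : R => (1 - z * x)^-1)).
Proof.
move=> z0; apply: (@integrable_bounded _ _ _ 1) => //.
  exact: measurable_eta_kernel.
move=> x /=; rewrite in_itv/= andbT => x0.
by have /andP[k0 k1] := eta_kernel_bound z0 x0; rewrite ger0_norm// ltW.
Qed.

Lemma Cauchy_eta_kernel mu z : on_nneg mu -> z < 0 ->
  Cauchy_transform mu z^-1 = z * eta_kernel mu z.
Proof.
move=> mu1 z0; rewrite /Cauchy_transform /eta_kernel.
rewrite -RintegralZl//; last by apply: integrable_eta_kernel; exact: ltW.
rewrite /Rintegral (@integral_carrier mu `[0%R, +oo[)//; last first.
  apply/measurable_EFinP; apply: (measurableT_comp measurable_inv).
  exact: measurable_funB.
congr fine; apply: eq_integral => x _; congr EFin.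
by rewrite -[z^-1 - x](@mulrK _ z) ?unitfE ?lt_eqF// mulrBl mulVf ?lt_eqF//
  invfM invrK mulrC (mulrC x).
Qed.

Lemma eta_transformE mu z : on_nneg mu -> z < 0 ->
  eta_transform mu z = 1 - (eta_kernel mu z)^-1.
Proof.
move=> mu1 z0; rewrite /eta_transform /F_transform Cauchy_eta_kernel//.
by rewrite invfM mulrA divff ?lt_eqF// mul1r.
Qed.

(** The default value 0 of the partial inverse lies outside (-oo, 0): a nonzero
    value is a genuine preimage.  This makes it possible to use an equation
    between transforms before knowing the range of the transform. *)
Lemma pinv_neq0 (f : R -> R) y : 'pinv_(fun=> 0) `]-oo, 0[ f y != 0 ->
  'pinv_(fun=> 0) `]-oo, 0[ f y < 0 /\ f ('pinv_(fun=> 0) `]-oo, 0[ f y) = y.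
Proof.
pose fS : set_surj `]-oo, 0[%classic (f @` `]-oo, 0[%classic) f := fun _ => id.
have -> : 'pinv_(fun=> 0) `]-oo, 0[ f y = odflt 0 ('oinv_fS y) by [].
rewrite oinv_surj; case: pselect => [yr _|_]/=; last by rewrite eqxx.
by case: cid2 => x /=; rewrite in_itv.
Qed.

Lemma pinv_inj (f : R -> R) x : {in `]-oo, 0[%classic &, injective f} -> x < 0 ->
  'pinv_(fun=> 0) `]-oo, 0[ f (f x) = x.
Proof. by move=> finj x0; rewrite pinvKV// inE/= in_itv. Qed.

Lemma eta_kernel_Sigma mu w : on_nneg mu -> w < 0 -> 0 < Sigma_transform mu w ->
  eta_kernel mu (w * Sigma_transform mu w) = (1 - w)^-1.
Proof.
move=> mu1 w0 S0.
set v := 'pinv_(fun=> 0) `]-oo, 0[ (eta_transform mu) w.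
have vE : w * Sigma_transform mu w = v.
  by rewrite /Sigma_transform mulrCA divff ?mulr1// lt_eqF.
have vn0 : v != 0 by rewrite -vE mulf_neq0// ?(lt_eqF w0)// (gt_eqF S0).
have [v0 ev] := pinv_neq0 vn0.
rewrite vE; move: ev; rewrite -/v eta_transformE// => <-.
by rewrite opprB addrCA subrr addr0 invrK.
Qed.

End HalfLineLaws.

(** * Moments from the Sigma-transform *)

Section Moments.
Context {R : realType}.
Implicit Types (mu : law R).

Local Notation nneg := (`[0%R, +oo[%classic : set (measurableTypeR R)).

Lemma eta_kernel_expand (z x : R) k : 1 - z * x != 0 ->
  (1 - z * x)^-1 = \sum_(j < k) z ^+ j * x ^+ j + z ^+ k * (x ^+ k / (1 - z * x)).
Proof.
move=> zx; have := subrX1 (z * x) k.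
under eq_bigr do rewrite exprMn.
set S := \sum_(i < k) _ => E.
rewrite mulrA -exprMn -{1}[(z * x) ^+ k](subrK 1) E.
by field.
Qed.

Lemma measurable_pow k (D : set (measurableTypeR R)) :
  measurable_fun D (fun x : measurableTypeR R => x ^+ k : R).
Proof. by apply: measurable_funTS; exact: measurable_funX. Qed.

Lemma integrable_pow mu k (c : R) : (\int[mu]_(x in nneg) (x ^+ k)%:E = c%:E)%E ->
  mu.-integrable nneg (EFin \o (fun x : R => x ^+ k)).
Proof.
move=> ck; apply/integrableP; split; first by apply/measurable_EFinP; exact: measurable_pow.
under eq_integral => x.
  rewrite inE/= in_itv/= andbT => x0; rewrite /= ger0_norm ?exprn_ge0//; over.
by rewrite ck ltry.
Qed.

Lemma Rintegral_moment_sum mu k (c a : nat -> R) :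
  (forall j, (j < k)%N -> (\int[mu]_(x in nneg) (x ^+ j)%:E = (c j)%:E)%E) ->
  mu.-integrable nneg (EFin \o (fun x : R => \sum_(j < k) a j * x ^+ j)) /\
  \int[mu]_(x in nneg) (\sum_(j < k) a j * x ^+ j) =
    \sum_(j < k) a j * c j.
Proof.
elim: k => [|k IH] ck.
  rewrite big_ord0; split.
    apply: (@eq_integrable _ _ _ mu nneg _ (cst 0%E)) => //.
      by move=> x _ /=; rewrite big_ord0.
    exact: integrable0.
  by under eq_Rintegral do rewrite big_ord0; rewrite /Rintegral integral0.
have [//|I1 E1] := IH _; first by move=> j /ltnW; exact: ck.
have I2 : mu.-integrable nneg (EFin \o (fun x : R => x ^+ k)).
  by apply: (@integrable_pow _ _ (c k)); exact: ck.
have I3 : mu.-integrable nneg (EFin \o (fun x : R => a k * x ^+ k)).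
  exact: (integrableZl (D := nneg) _ (a k) I2).
split.
  apply: (@eq_integrable _ _ _ mu nneg _ _ _ _ (integrableD _ I1 I3)) => //.
  by move=> x _ /=; rewrite big_ord_recr.
under eq_Rintegral do rewrite big_ord_recr/=.
rewrite RintegralD// E1 big_ord_recr/= RintegralZl//; congr (_ + _ * _).
by rewrite /Rintegral ck.
Qed.

(** An expansion of A along one sequence of negative points tending to 0 gives
    the moments one after the other.  If those below k are known, the expansion
    determines the limit c_k of the integrals of [g_n(x) = x^k/(1 - z_n x)].
    These functions are at most x^k and tend to it, so the k-th moment is at
    least c_k, and at most c_k by Fatou. *)
Lemma moments_of_eta_kernel mu N (c : nat -> R) (z : R^nat) C :
  (forall n, z n < 0) -> z @ \oo --> 0 ->
  (\forall n \near \oo,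
    `|eta_kernel mu (z n) - \sum_(j < N) z n ^+ j * c j| <= C * `|z n| ^+ N) ->
  forall k, (k < N)%N -> (\int[mu]_(x in nneg) (x ^+ k)%:E = (c k)%:E)%E.
Proof.
move=> z0 zc HC; elim/ltn_ind => k IH kN.
pose g n (x : R) := x ^+ k / (1 - z n * x).
have g_ge0 n x : nneg x -> 0 <= g n x.
  rewrite /= in_itv/= andbT => x0.
  have /andP[k0 _] := eta_kernel_bound (ltW (z0 n)) x0.
  by rewrite mulr_ge0 ?exprn_ge0// ltW.
have g_le n x : nneg x -> g n x <= x ^+ k.
  rewrite /= in_itv/= andbT => x0.
  have /andP[_ k1] := eta_kernel_bound (ltW (z0 n)) x0.
  by rewrite ler_piMr// exprn_ge0.
have mg n : measurable_fun nneg (EFin \o g n).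
  apply/measurable_EFinP/measurable_funM; first exact: measurable_pow.
  exact: measurable_eta_kernel.
have Ig n : mu.-integrable nneg (EFin \o g n) /\
    \int[mu]_(x in nneg) g n x =
    (z n) ^- k * (eta_kernel mu (z n) - \sum_(j < k) z n ^+ j * c j).
  have [I1 E1] := @Rintegral_moment_sum mu k c (fun j => z n ^+ j)
    (fun j jk => IH j jk (ltn_trans jk kN)).
  have I2 := integrable_eta_kernel mu (ltW (z0 n)).
  have I3 := integrableB _ I2 I1.
  have gE x : nneg x -> g n x = z n ^- k * ((1 - z n * x)^-1 - \sum_(j < k) z n ^+ j * x ^+ j).
    rewrite /= in_itv/= andbT => x0.
    have /andP[k0 _] := eta_kernel_bound (ltW (z0 n)) x0.
    have zx : 1 - z n * x != 0 by rewrite gt_eqF// -invr_gt0.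
    have zk : z n ^+ k != 0 by rewrite expf_neq0// lt_eqF.
    have := eta_kernel_expand k zx; set S := \sum_(j < k) _ => ->.
    by rewrite [S + _]addrC addrK mulKf.
  split.
    apply: (@eq_integrable _ _ _ mu nneg _ (fun x => (z n ^- k)%:E *
      ((1 - z n * x)^-1 - \sum_(j < k) z n ^+ j * x ^+ j)%:E)%E) => //.
      by move=> x; rewrite inE => /gE /= ->.
    by apply: integrableZl => //; exact: I3.
  under eq_Rintegral => x do rewrite inE => /gE ->.
  rewrite RintegralZl//; last exact: I3.
  by rewrite RintegralB// E1.
have cvg_g : \int[mu]_(x in nneg) g n x @[n --> \oo] --> c k.
  pose m := (N - k)%N; pose P := \poly_(i < m) c (k + i)%N.
  have NE : N = (k + m)%N by rewrite subnKC// ltnW.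
  have m0 : (0 < m)%N by rewrite subn_gt0.
  have zn0 n : z n != 0 by rewrite lt_eqF.
  have gE n : \int[mu]_(x in nneg) g n x =
      z n ^- k * (eta_kernel mu (z n) - \sum_(j < N) z n ^+ j * c j) + P.[z n].
    rewrite (Ig n).2 NE big_split_ord/= opprD addrA [in RHS]mulrDr.
    rewrite -[LHS]addr0 -addrA; congr (_ + _).
    rewrite horner_poly mulrN mulr_sumr addrC; apply/esym/eqP; rewrite subr_eq0; apply/eqP.
    apply: eq_bigr => i _; rewrite exprD mulrA [_ * (_ * _)]mulrA mulVf ?expf_neq0// mul1r.
    by rewrite mulrC.
  have P0 : P.[0] = c k by rewrite horner_coef0 coef_poly m0 addn0.
  have PC : P.[z n] @[n --> \oo] --> c k.
    rewrite -P0; apply: (@cvg_comp _ _ _ z (horner P) _ (nbhs 0)) => //.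
    exact: continuous_horner.
  suff D0 : z n ^- k * (eta_kernel mu (z n) - \sum_(j < N) z n ^+ j * c j)
      @[n --> \oo] --> 0.
    rewrite -[c k]add0r; under eq_fun do rewrite gE; exact: cvgD.
  apply/norm_cvg0P; apply: (@squeeze_cvgr _ _ _ _ (fun=> 0) (fun n => C * `|z n| ^+ m)).
  - near=> n; rewrite normr_ge0/= normrM normfV normrX.
    rewrite mulrC ler_pdivrMr ?exprn_gt0 ?normr_gt0// -mulrA -exprD addnC -NE.
    by near: n.
  - exact: cvg_cst.
  - have : C * `|z n| ^+ m @[n --> \oo] --> C * `|0 : R| ^+ m.
      apply: cvgM; first exact: cvg_cst.
      apply: (@cvg_comp _ _ _ (fun n => `|z n|) (fun x => x ^+ m) _ (nbhs `|0 : R|)).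
        exact: cvg_norm.
      exact: exprn_continuous.
    by rewrite normr0 expr0n gtn_eqF// mulr0.
have cvgE : (\int[mu]_(x in nneg) (g n x)%:E)%E @[n --> \oo] --> (c k)%:E.
  apply: cvg_EFin => //; apply: nearW => n.
  by apply: integrable_fin_num => //; exact: (Ig n).1.
apply/eqP; rewrite eq_le; apply/andP; split.
  have [<- _] := cvg_limn_einf_sup cvgE.
  have lim_g x : x \in nneg -> (x ^+ k)%:E = limn_einf (fun n => (g n x)%:E).
    move=> _; apply/esym; apply: (cvg_limn_einf_sup _).1.
    apply: cvg_EFin; first by apply: nearW.
    rewrite -[x ^+ k]mulr1 -invr1; apply: cvgM; first exact: cvg_cst.
    apply: cvgV; first by rewrite oner_neq0.
    rewrite -[X in _ --> X]subr0 -[X in _ --> _ - X](mul0r x).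
    by apply: cvgB; [exact: cvg_cst|apply: cvgM => //; exact: cvg_cst].
  rewrite (eq_integral _ _ lim_g).
  by have := @fatou _ _ _ mu nneg _ (fun n => EFin \o g n) mg; apply.
apply: (cvge_le _ cvgE) => //.
near=> n; apply: ge0_le_integral => //.
- by move=> x xD; rewrite lee_fin g_ge0.
- exact: mg.
- by apply/measurable_EFinP; exact: measurable_pow.
- by move=> x xD; rewrite lee_fin g_le.
Unshelve. all: by end_near. Qed.

End Moments.

Section MomentsOfSigma.
Context {R : realType}.
Implicit Types (mu : law R).

Local Notation nneg := (`[0%R, +oo[%classic : set (measurableTypeR R)).

Lemma near0N_seq (P : R -> Prop) : (\forall w \near 0^'-, P w) ->
  exists w : R^nat, [/\ forall n, w n < 0, w @ \oo --> 0 & forall n, P (w n)].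
Proof.
move=> [d /= d0 HP]; exists (fun n => - (d / 2) * n.+1%:R^-1).
have w0 n : - (d / 2) * n.+1%:R^-1 < 0.
  by rewrite mulNr oppr_lt0 mulr_gt0 ?invr_gt0// divr_gt0.
split=> //.
- rewrite -[X in _ --> X](mulr0 (- (d / 2))).
  by apply: cvgM; [exact: cvg_cst|exact: cvg_harmonic].
- move=> n; apply: HP => //=.
  rewrite sub0r normrN ltr0_norm// mulNr opprK.
  rewrite ltr_pdivrMr ?ltr0n// ltr_pdivrMr// -mulrA ltr_pMr//.
  by rewrite -natrM ltr1n muln2.
Qed.

Lemma expands_bounded f (p : {poly R}) N : expands f p N ->
  exists2 B : R, 0 < B & \forall w \near 0^'-, `|f w| <= B.
Proof.
move=> [C HC]; have [B B0 HB] := horner_bounded p.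
exists (`|C| + B + 1); first by rewrite ltr_pwDr// addr_ge0.
near=> w; have [w0 w1] : w < 0 /\ `|w| <= 1 by near: w; exact: near0N_norm.
rewrite -[f w](subrK p.[w]) (le_trans (ler_normD _ _))// ler_wpDr// lerD ?HB//.
apply: (@le_trans _ _ (C * `|w| ^+ N)); first by near: w.
by rewrite (le_trans (ler_norm _))// normrM ler_piMr// normrX normr_id exprn_ile1.
Unshelve. all: by end_near. Qed.

(** The coefficients c_j of the expansion of 1/(1-w) along the powers of
    [w phi(w)] are the moments, since the kernel takes the value 1/(1-w) at the
    point [w phi(w)]; Lagrange inversion computes them, with
    [(1-w)^(-2)] as the derivative of 1/(1-w). *)
Lemma moments_of_Sigma mu (phi : R -> R) N (P Q : {poly R}) : on_nneg mu ->
  (\forall w \near 0^'-, Sigma_transform mu w = phi w /\ 0 < phi w) ->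
  expands phi P N.+1 -> expands (fun w => (phi w)^-1) Q N.+1 ->
  forall k, (0 < k <= N)%N ->
  (\int[mu]_(x in nneg) (x ^+ k)%:E =
   ((binom_poly 2 1 N * Q ^+ k)`_k.-1 / k%:R)%:E)%E.
Proof.
move=> mu0 Sphi phiP phiQ k kN.
have PQ : eq_modXn N.+1 (P * Q) 1.
  apply: (expands_unique (expandsM phiP phiQ)).
  apply: expands_eq (expands_poly 1 N.+1); near=> w.
  by rewrite hornerC divff// gt_eqF//; near: w; apply: filterS Sphi => w [].
have P0 : P`_0 != 0.
  have := eq_modXn_coef (i := 0) PQ isT; rewrite coef0M coefC/= => PQ0.
  by apply/eqP => P0; move/eqP: PQ0; rewrite P0 mul0r eq_sym oner_eq0.
pose h : {poly R} := binom_poly 1 1 N.+1.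
have [c hc] := powers_modXn_basis h P0 N.+1.
have [BP BP0 HBP] := expands_bounded phiP.
have [BQ BQ0 HBQ] := expands_bounded phiQ.
pose chi w := w * phi w.
have chiP : expands chi ('X * P) N.+1.
  apply: expandsM => //.
  by apply: expands_eq (expands_poly 'X N.+1); apply: nearW => w; rewrite hornerX.
have [C HC] : expands (fun w => (1 - w)^-1 - \sum_(j < N.+1) chi w ^+ j * c j) 0 N.+1.
  have Eh := expands_binom 1 N.+1 (@ler01 R).
  have Es := @expands_sum _ N.+1 (fun j w => c j * chi w ^+ j) _ N.+1
    (fun j => expandsZ (c j) (expands_exp j chiP)).
  have := expandsD Eh (expandsZ (-1) Es).
  have H : eq_modXn N.+1 (h + -1 *: \sum_(j < N.+1) c j *: ('X * P) ^+ j) 0.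
    by have [r ->] := hc; exists r; rewrite scaleN1r; ring.
  move=> /expands_modXn => /(_ _ H); apply: expands_eq.
  near=> w; rewrite mul1r powR_inv1; last first.
    by rewrite subr_ge0 (le_trans _ ler01)//; near: w; exact: nbhs_left_le.
  by rewrite mulN1r; under eq_bigr do rewrite mulrC.
have Hnear : \forall w \near 0^'-,
  [/\ Sigma_transform mu w = phi w, 0 < phi w, `|phi w| <= BP, `|(phi w)^-1| <= BQ &
    `|(1 - w)^-1 - \sum_(j < N.+1) chi w ^+ j * c j| <= C * `|w| ^+ N.+1].
  near=> w.
  have [S1 p0] : Sigma_transform mu w = phi w /\ 0 < phi w by near: w.
  split=> //; [by near: w|by near: w|].
  by near: w; apply: filterS HC => w; rewrite horner0 subr0.
have [w [w0 wc Hw]] := near0N_seq Hnear.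
have -> : (binom_poly 2 1 N * Q ^+ k)`_k.-1 / k%:R = c k.
  have PQN : eq_modXn N (P * Q) 1.
    by have [r ->] := PQ; exists (r * 'X); rewrite exprS; ring.
  have := Lagrange_inversion PQN hc kN.
  rewrite deriv_binom_poly !mul1r scale1r -[1 + 1]/(2%:R) => <-.
  by rewrite -(mulr_natr (c k)) mulfK// pnatr_eq0 -lt0n; case/andP: kN.
(* |w| <= |chi w| |1 / phi w| turns an error in |w| into one in |chi w| *)
apply: (@moments_of_eta_kernel _ mu N.+1 c (fun n => chi (w n)) (`|C| * BQ ^+ N.+1)).
- move=> n; have [_ p0 _ _ _] := Hw n.
  by rewrite /chi pmulr_llt0.
- apply/norm_cvg0P.
  apply: (@squeeze_cvgr _ _ _ _ (fun=> 0) (fun n => BP * `|w n|)).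
  + near=> n; rewrite normr_ge0/= /chi normrM mulrC ler_wpM2r//.
    by have [_ _ + _ _] := Hw n.
  + exact: cvg_cst.
  + rewrite -[X in _ --> X](mulr0 BP) -(@normr0 _ R).
    by apply: cvgM; [exact: cvg_cst|exact: cvg_norm].
- apply: nearW => n; have [S1 p0 p1 p2 p3] := Hw n.
  have -> : eta_kernel mu (chi (w n)) = (1 - w n)^-1.
    by rewrite /chi -S1 eta_kernel_Sigma// S1.
  apply: (le_trans p3).
  apply: (@le_trans _ _ (`|C| * `|w n| ^+ N.+1)).
    by rewrite ler_wpM2r ?exprn_ge0// ler_norm.
  rewrite -mulrA ler_wpM2l// -exprMn lerXn2r ?nnegrE ?mulr_ge0// ?(ltW BQ0)//.
  rewrite /chi normrM (gtr0_norm p0) mulrCA -[leLHS]mulr1 ler_wpM2l//.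
  by rewrite -ler_pdivrMr// div1r (le_trans _ p2)// ler_norm.
- by case/andP: kN.
Unshelve. all: by end_near. Qed.

End MomentsOfSigma.

(** * Real powers *)

Section RealPowers.
Context {R : realType}.
Implicit Types (a b n p u v y : R).

(** The Young inequality for b and 1, with exponents p and p/(p-1). *)
Lemma Bernoulli_powR (b p : R) : 0 <= b -> 1 <= p -> 1 + p * (b - 1) <= b `^ p.
Proof.
move=> b0; rewrite le_eqVlt => /predU1P[<-|p1].
  by rewrite powRr1// mul1r addrC subrK.
have p0 : 0 < p by apply: lt_trans p1.
have p1n : p - 1 != 0 by rewrite subr_eq0 gt_eqF.
have q0 : 0 < p / (p - 1) by rewrite divr_gt0// subr_gt0.
have := @conjugate_powR _ b 1 p (p / (p - 1)) b0 ler01 p0 q0.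
rewrite powR1 mulr1 => /(_ _) H.
have {}H : b <= b `^ p / p + 1 / (p / (p - 1)).
  by apply: H; field; rewrite p1n gt_eqF.
move: H; rewrite -(ler_pM2r p0) mulrDl divfK ?gt_eqF//.
have -> : 1 / (p / (p - 1)) * p = p - 1 by field; rewrite p1n gt_eqF.
by lra.
Qed.

Lemma gt0_powRD y a b : 0 < y -> y `^ (a + b) = y `^ a * y `^ b.
Proof. by move=> y0; rewrite powRD// (gt_eqF y0) implybT. Qed.

Lemma gt0_powRS y a : 0 < y -> y `^ (1 + a) = y * y `^ a.
Proof. by move=> y0; rewrite gt0_powRD// powRr1// ltW. Qed.

Lemma gt0_powR_expR y a : 0 < y -> y `^ a = expR (a * ln y).
Proof. by move=> y0; rewrite /powR gt_eqF. Qed.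

Lemma cvg_powR {T : Type} (F : set_system T) {FF : ProperFilter F}
    (f g : T -> R) (a b : R) : 0 < a ->
  f x @[x --> F] --> a -> g x @[x --> F] --> b -> f x `^ g x @[x --> F] --> a `^ b.
Proof.
move=> a0 fa gb; rewrite (gt0_powR_expR _ a0).
have H : expR (g x * ln (f x)) @[x --> F] --> expR (b * ln a).
  apply: (@cvg_comp _ _ _ _ (@expR R) _ (nbhs (b * ln a))).
    apply: cvgM => //; apply: (@cvg_comp _ _ _ f (@ln R) _ (nbhs a)) => //.
    exact: continuous_ln.
  exact: continuous_expR.
apply: cvg_trans H; apply: near_eq_cvg; near=> x.
rewrite gt0_powR_expR//; near: x; exact: (cvgr_gt _ fa).
Unshelve. all: by end_near. Qed.

(** The Bernoulli inequality for the (v-u)/(n-u)-th power of y^(n-u). *)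
Lemma power_interpolation y n u v : 0 <= y -> 0 < u -> u <= n -> n < v ->
  y `^ n <= y `^ u + (n - u) / (v - u) * y `^ v.
Proof.
move=> y0 u0; rewrite le_eqVlt => /predU1P[<- uv|un nv]; first by rewrite subrr !mul0r addr0.
have n0 : 0 < n by exact: lt_trans un.
have v0 : 0 < v by exact: lt_trans nv.
have uv : 0 < v - u by rewrite subr_gt0 (lt_trans un).
set theta := _ / _; have th0 : 0 < theta by rewrite divr_gt0// subr_gt0.
have th1 : theta <= 1 by rewrite ler_pdivrMr// mul1r lerB// ltW.
move: y0; rewrite le_eqVlt => /predU1P[<-|y0].
  by rewrite !powR0 ?gt_eqF// mulr0 addr0.
pose b := y `^ (n - u).
have bE : b `^ theta^-1 = y `^ (v - u).
  by rewrite -powRrM /theta invf_div mulrCA divff ?mulr1// gt_eqF// subr_gt0.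
have th2 : 1 <= theta^-1 by rewrite -invr1 lef_pV2 ?posrE.
have := Bernoulli_powR (powR_ge0 y (n - u)) th2; rewrite -/b bE => H.
have {}H : b <= 1 + theta * y `^ (v - u).
  rewrite -(ler_pM2l th0) mulrDr mulr1 mulrA divff ?mul1r ?gt_eqF// in H.
  by lra.
have -> : y `^ n = y `^ u * b by rewrite -gt0_powRD// addrC subrK.
have -> : y `^ v = y `^ u * y `^ (v - u) by rewrite -gt0_powRD// addrC subrK.
by rewrite mulrCA -[X in X + _]mulr1 -mulrDr ler_wpM2l// powR_ge0.
Qed.

Lemma power_lower y n u : 0 < u -> u <= n ->
  y `^ u <= y `^ n + (n / u - 1).
Proof.
move=> u0 un; have p1 : 1 <= n / u by rewrite ler_pdivlMr// mul1r.
have b0 := powR_ge0 y u.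
have := Bernoulli_powR b0 p1.
have -> : (y `^ u) `^ (n / u) = y `^ n.
  by rewrite -powRrM [u * _]mulrC divfK// gt_eqF.
by move: (y `^ u) (y `^ n) (n / u) b0 p1 => b a p b0 p1; nra.
Qed.

End RealPowers.

(** * The Gamma function *)

Section GammaFunction.
Context {R : realType}.
Implicit Types (x y a : R).
Local Notation leb := (@lebesgue_measure R).
Local Notation pos := (`]0%R, +oo[%classic : set R).

Lemma powR_le_expR a y : 0 <= a -> 0 <= y -> y `^ a <= (2 * a) `^ a * expR (y / 2).
Proof.
rewrite le_eqVlt => /predU1P[<- y0|a0 y0].
  by rewrite !powRr0 mul1r -expR0 ler_expR divr_ge0.
have a20 : 0 < 2 * a by rewrite mulr_gt0.
have -> : expR (y / 2) = expR (y / (2 * a)) `^ a.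
  by rewrite -expRM; congr expR; field; rewrite gt_eqF.
rewrite -powRM ?expR_ge0 ?(ltW a20)//.
apply: ge0_ler_powR; rewrite ?nnegrE ?(ltW a0)//.
  by rewrite mulr_ge0 ?expR_ge0// ltW.
rewrite mulrC -ler_pdivrMr// (le_trans _ (expR_ge1Dx _))//.
by rewrite lerDr.
Qed.

Definition Gamma_integrand x y := y `^ (x - 1) * expR (- y).

Lemma continuous_powR_pos a y : 0 < y -> {for y, continuous (fun y => y `^ a)}.
Proof.
move=> y0; apply/differentiable_continuous/derivable1_diffP.
by apply: derivable_powR; rewrite in_itv/= y0.
Qed.

Lemma cvg_powR_at0 a : 0 <= a -> y `^ a @[y --> 0^'+] --> (0 : R) `^ a.
Proof.
rewrite le_eqVlt => /predU1P[<-|a0].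
  under eq_fun do rewrite powRr0.
  by rewrite powRr0; exact: cvg_cst.
by rewrite powR0 ?gt_eqF//; exact: powR_cvg0.
Qed.

Lemma continuous_exp_lin c : continuous (fun y : R => expR (c * y)).
Proof.
move=> y; apply: continuous_comp; last exact: continuous_expR.
by apply: continuousM => //; exact: cst_continuous.
Qed.

Lemma continuous_Gamma_integrand x y : 0 < y ->
  {for y, continuous (Gamma_integrand x)}.
Proof.
move=> y0; apply: cvgM; first exact: continuous_powR_pos.
by have := @continuous_exp_lin (-1) y; under eq_fun do rewrite mulN1r.
Qed.

Lemma cvg_Gamma_integrand_at0 x : 1 <= x ->
  Gamma_integrand x y @[y --> 0^'+] --> Gamma_integrand x 0.
Proof.
move=> x1; apply: cvgM; first by apply: cvg_powR_at0; rewrite subr_ge0.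
apply: cvg_at_right_filter.
by have := @continuous_exp_lin (-1) 0; under eq_fun do rewrite mulN1r.
Qed.

Lemma cvg_exp_lin c : 0 < c -> expR (- c * y) @[y --> +oo] --> (0 : R).
Proof.
move=> c0.
rewrite (_ : (fun y => expR (- c * y)) = (fun z => expR (- z)) \o (fun y => c * y)); last first.
  by apply/funext => y /=; rewrite mulNr.
by apply: (@cvg_comp _ _ _ _ _ _ (pinfty_nbhs R)); [exact: gt0_cvgMry|exact: cvgr_expR].
Qed.

Lemma is_derive_exp_lin c y : is_derive y 1 (fun y : R => expR (c * y)) (c * expR (c * y)).
Proof.
have D1 : is_derive y 1 (fun y : R => c * y) c.
  by apply: is_derive_eq; exact: mulr1.
apply: (is_derive_eq (@is_derive1_comp R (@expR R) (fun y : R => c * y) y _ _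
  (is_derive_expR _) D1)).
by rewrite mulrC.
Qed.

Lemma integral_exp_lin c : 0 < c ->
  (\int[leb]_(y in `[0%R, +oo[) (expR (- c * y))%:E = (c^-1)%:E)%E.
Proof.
move=> c0; have D y : is_derive y 1 (fun y : R => - c^-1 * expR (- c * y)) (expR (- c * y)).
  apply: (is_derive_eq (is_deriveZ (- c^-1) (is_derive_exp_lin (- c) y))).
  by rewrite -[LHS]/(- c^-1 * (- c * expR (- c * y))) mulrA mulrNN mulVf ?mul1r// gt_eqF.
rewrite (@ge0_continuous_FTC2y _ _ (fun y => - c^-1 * expR (- c * y)) _ 0).
- by rewrite mulr0 expR0 mulr1 sub0e -EFinN opprK.
- by move=> y _; exact: expR_ge0.
- by apply: continuous_subspaceT; exact: continuous_exp_lin.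
- rewrite -[X in _ --> X](mulr0 (- c^-1)); apply: cvgM; first exact: cvg_cst.
  exact: cvg_exp_lin.
- by move=> y _; apply: ex_derive; exact: D.
- apply: cvg_at_right_filter; apply: cvgM; first exact: cvg_cst.
  exact: continuous_exp_lin.
- by move=> y _; rewrite derive1E; apply: derive_val; exact: D.
Qed.

Lemma Gamma_integrandD x a y : 0 < y ->
  Gamma_integrand (x + a) y = y `^ a * Gamma_integrand x y.
Proof.
move=> y0; by rewrite /Gamma_integrand addrAC (gt0_powRD (x - 1) a y0); ring.
Qed.

Lemma Gamma_integrandS x y : 0 < y ->
  Gamma_integrand (x + 1) y = y * Gamma_integrand x y.
Proof. by move=> y0; rewrite Gamma_integrandD// powRr1// ltW. Qed.

Definition exp_bound x := (2 * x) `^ x.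

Lemma Gamma_integrand_ge0 x y : 0 <= Gamma_integrand x y.
Proof. by rewrite mulr_ge0 ?powR_ge0 ?expR_ge0. Qed.

Lemma Gamma_integrand_le x y : 1 <= x -> 0 <= y ->
  Gamma_integrand x y <= exp_bound (x - 1) * expR (- 2^-1 * y).
Proof.
move=> x1 y0; have -> : - 2^-1 * y = y / 2 - y by field.
rewrite expRD mulrA ler_wpM2r ?expR_ge0// powR_le_expR//.
by rewrite subr_ge0.
Qed.

Lemma measurable_Gamma_integrand x (D : set R) : measurable_fun D (Gamma_integrand x).
Proof.
apply: measurable_funTS; apply: measurable_funM; first exact: measurable_powR.
by apply: measurableT_comp => //; exact: measurableT_comp.
Qed.

Lemma measurable_exp_lin c (D : set R) : measurable_fun D (fun y : R => expR (c * y)).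
Proof.
by apply: measurable_funTS; apply: measurableT_comp => //; exact: measurable_funM.
Qed.

Lemma integrable_exp_half : leb.-integrable pos (EFin \o (fun y : R => expR (- 2^-1 * y))).
Proof.
have mE (D : set R) : measurable_fun D (fun y : R => expR (- 2^-1 * y)).
  exact: measurable_exp_lin.
apply/integrableP; split; first by apply/measurable_EFinP; exact: mE.
under eq_integral do rewrite /= ger0_norm ?expR_ge0//.
rewrite integral_itv_obnd_cbnd ?integral_exp_lin ?ltry//.
by apply/measurable_EFinP; exact: mE.
Qed.

Lemma integrable_Gamma x : 1 <= x ->
  leb.-integrable pos (EFin \o Gamma_integrand x).
Proof.
move=> x1; apply: (@le_integrable _ _ _ leb pos _ _
  (EFin \o (fun y => exp_bound (x - 1) * expR (- 2^-1 * y)))) => //.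
- by apply/measurable_EFinP; exact: measurable_Gamma_integrand.
- move=> y /=; rewrite in_itv/= andbT => y0.
  rewrite lee_fin !ger0_norm ?mulr_ge0 ?powR_ge0 ?expR_ge0//.
  by apply: Gamma_integrand_le => //; exact: ltW.
- by apply: (@integrableZl _ _ _ leb pos _ _ _ integrable_exp_half).
Qed.

Lemma GammaE x : Gamma x = \int[leb]_(y in pos) Gamma_integrand x y.
Proof. by []. Qed.

Lemma is_derive_Gamma_primitive x y : 0 < y ->
  is_derive y 1 (Gamma_integrand (x + 1)) (x * Gamma_integrand x y - Gamma_integrand (x + 1) y).
Proof.
move=> y0; rewrite /Gamma_integrand addrK.
have D1 := is_derive1_powR x y0.
have D2 : is_derive y 1 (fun y : R => expR (- y)) (- expR (- y)).
  have -> : (fun y : R => expR (- y)) = (fun y => expR (- 1 * y)).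
    by apply/funext => z; rewrite mulN1r.
  by apply: (is_derive_eq (is_derive_exp_lin (- 1) y)); rewrite mulN1r mulN1r.
apply: (is_derive_eq (is_deriveM D1 D2)).
rewrite -[LHS]/(y `^ x * - expR (- y) + expR (- y) * (x * y `^ (x - 1))); ring.
Qed.

(** Integration by parts, arranged so that only a nonnegative function is
    integrated up to +oo: a multiple of exp(-y/2) is added to the derivative of
    y^x exp(-y), large enough to make it nonnegative. *)
Lemma Gamma_rec x : 1 <= x -> Gamma (x + 1) = x * Gamma x.
Proof.
move=> x1; have x0 : 0 <= x by apply: le_trans x1.
pose C := x * exp_bound (x - 1).
pose h y := Gamma_integrand (x + 1) y - x * Gamma_integrand x y + C * expR (- 2^-1 * y).
pose H y := - Gamma_integrand (x + 1) y - C * 2 * expR (- 2^-1 * y).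
have dH y : 0 < y -> is_derive y 1 H (h y).
  move=> y0.
  have D1 := is_derive_Gamma_primitive x y0.
  have D2 := is_deriveZ (C * 2) (is_derive_exp_lin (- 2^-1) y).
  apply: (is_derive_eq (is_deriveB (is_deriveN D1) D2)).
  rewrite -[X in _ - X]/(C * 2 * (- 2^-1 * expR (- 2^-1 * y))) /h; by field.
have h0 y : 0 <= y -> 0 <= h y.
  move=> y0; rewrite /h -addrA addr_ge0 ?Gamma_integrand_ge0// addrC subr_ge0.
  by rewrite -mulrA ler_wpM2l// Gamma_integrand_le.
have x1' : 1 <= x + 1 by rewrite lerDr.
have I : (\int[leb]_(y in `[0%R, +oo[) (h y)%:E = 0%:E - (H 0)%:E)%E.
  apply: ge0_continuous_FTC2y => //.
  - apply/continuous_within_itvcyP; split.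
      move=> y; rewrite in_itv/= andbT => y0; apply: cvgD; first apply: cvgB.
      + exact: continuous_Gamma_integrand.
      + by apply: cvgM; [exact: cvg_cst|exact: continuous_Gamma_integrand].
      + by apply: cvgM; [exact: cvg_cst|exact: continuous_exp_lin].
    apply: cvgD; first apply: cvgB.
    + exact: cvg_Gamma_integrand_at0.
    + by apply: cvgM; [exact: cvg_cst|exact: cvg_Gamma_integrand_at0].
    + apply: cvgM; first exact: cvg_cst.
      by apply: cvg_at_right_filter; exact: continuous_exp_lin.
  - have cG : Gamma_integrand (x + 1) y @[y --> +oo] --> 0.
      apply: (@squeeze_cvgr _ _ _ _ (fun=> 0)
        (fun y => exp_bound (x + 1 - 1) * expR (- 2^-1 * y))).
      + near=> y; rewrite Gamma_integrand_ge0 Gamma_integrand_le//=.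
      + exact: cvg_cst.
      + rewrite -[X in _ --> X](mulr0 (exp_bound (x + 1 - 1))).
        by apply: cvgM; [exact: cvg_cst|by apply: cvg_exp_lin].
    have : - Gamma_integrand (x + 1) y - C * 2 * expR (- 2^-1 * y)
        @[y --> +oo] --> - 0 - C * 2 * 0.
      apply: cvgB; first exact: cvgN.
      by apply: cvgM; [exact: cvg_cst|by apply: cvg_exp_lin].
    by rewrite oppr0 mulr0 subr0.
  - by move=> y y0; apply: ex_derive; exact: dH.
  - apply: cvgB; first by apply: cvgN; exact: cvg_Gamma_integrand_at0.
    apply: cvgM; first exact: cvg_cst.
    by apply: cvg_at_right_filter; exact: continuous_exp_lin.
  - move=> y; rewrite in_itv/= andbT => y0; rewrite derive1E.
    by apply: derive_val; exact: dH.
have H0 : H 0 = - (2 * C).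
  rewrite /H /Gamma_integrand addrK powR0 ?gt_eqF ?(lt_le_trans ltr01)//.
  by rewrite mul0r oppr0 mulr0 expR0; ring.
have mh (D : set R) : measurable_fun D h.
  apply: measurable_funD; first apply: measurable_funB.
  - exact: measurable_Gamma_integrand.
  - by apply: measurable_funM => //; exact: measurable_Gamma_integrand.
  - by apply: measurable_funM => //; exact: measurable_exp_lin.
have I1 := integrable_Gamma x1.
have I2 := integrable_Gamma x1'.
have I3 := integrable_exp_half.
have : \int[leb]_(y in pos) h y = 2 * C.
  rewrite /Rintegral integral_itv_obnd_cbnd.
    by rewrite I H0 -EFinB/= sub0r opprK.
  by apply/measurable_EFinP; exact: mh.
have I2x := @integrableZl _ _ _ leb pos (measurable_itv _) x _ I1.
have I3C := @integrableZl _ _ _ leb pos (measurable_itv _) C _ I3.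
rewrite /h RintegralD//.
  2: by apply: (@integrableB _ _ _ leb pos (measurable_itv _) _ _ I2 I2x).
rewrite RintegralB// !RintegralZl// -!GammaE.
have -> : \int[leb]_(y in pos) expR (- 2^-1 * y) = 2.
  rewrite /Rintegral integral_itv_obnd_cbnd ?integral_exp_lin ?invrK//.
  by apply/measurable_EFinP; apply: measurable_exp_lin.
lra.
Unshelve. all: by end_near. Qed.

(** The bounds x^a <= Gamma(x+a)/Gamma(x) <= (x+a)^a come from integrating a
    Bernoulli inequality for a power of y against the Gamma density, and using
    the functional equation; here, (y/x)^a >= 1 + a (y/x - 1). *)
Lemma Gamma_bernoulli_ge x a : 1 <= x -> 1 <= a ->
  x `^ a * Gamma x <= Gamma (x + a).
Proof.
move=> x1 a1; have x0 : 0 < x by apply: lt_le_trans x1.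
have I1 := integrable_Gamma x1.
have I2 : leb.-integrable pos (EFin \o Gamma_integrand (x + 1)).
  by apply: integrable_Gamma; rewrite (le_trans x1)// lerDl.
have I3 : leb.-integrable pos (EFin \o Gamma_integrand (x + a)).
  by apply: integrable_Gamma; rewrite (le_trans x1)// lerDl (le_trans _ a1).
have I1c := @integrableZl _ _ _ leb pos (measurable_itv _) (x `^ a * (1 - a)) _ I1.
have I2c := @integrableZl _ _ _ leb pos (measurable_itv _) (x `^ a * a / x) _ I2.
have -> : x `^ a * Gamma x = \int[leb]_(y in pos)
    (x `^ a * (1 - a) * Gamma_integrand x y + x `^ a * a / x * Gamma_integrand (x + 1) y).
  rewrite RintegralD// !RintegralZl// -!GammaE Gamma_rec//.
  by field; rewrite gt_eqF.
rewrite GammaE; apply: le_Rintegral => //.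
  exact: (@integrableD _ _ _ leb pos (measurable_itv _) _ _ I1c I2c).
move=> y /=; rewrite in_itv/= andbT => y0.
have yx0 : 0 <= y / x by rewrite divr_ge0 ?ltW.
have := Bernoulli_powR yx0 a1.
rewrite -(ler_pM2l (powR_gt0 a x0)) -powRM ?(ltW x0)// mulrCA divff ?gt_eqF// mulr1.
rewrite Gamma_integrandS// Gamma_integrandD//.
move=> /(ler_wpM2r (Gamma_integrand_ge0 x y)); apply: le_trans.
rewrite le_eqVlt; apply/orP; left; apply/eqP; field; rewrite gt_eqF//.
Qed.

(** Here, (c/y)^(1+a) >= 1 + (1+a) (c/y - 1) with c = x+a. *)
Lemma Gamma_bernoulli_le x a : 1 <= x -> 0 <= a ->
  Gamma (x + a) <= (x + a) `^ a * Gamma x.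
Proof.
move=> x1 a0; set c := x + a.
have c1 : 1 <= c by rewrite (le_trans x1)// lerDl.
have c0 : 0 < c by apply: lt_le_trans c1.
have I1 := integrable_Gamma x1.
have I2 : leb.-integrable pos (EFin \o Gamma_integrand c) by exact: integrable_Gamma.
have I3 : leb.-integrable pos (EFin \o Gamma_integrand (c + 1)).
  by apply: integrable_Gamma; rewrite (le_trans c1)// lerDl.
have I1c := @integrableZl _ _ _ leb pos (measurable_itv _) (c `^ a) _ I1.
have I2c := @integrableZl _ _ _ leb pos (measurable_itv _) (1 + a) _ I2.
have I3c := @integrableZl _ _ _ leb pos (measurable_itv _) (a / c) _ I3.
have -> : Gamma c = \int[leb]_(y in pos)
    ((1 + a) * Gamma_integrand c y - a / c * Gamma_integrand (c + 1) y).
  rewrite RintegralB// !RintegralZl// -!GammaE Gamma_rec//.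
  by field; rewrite gt_eqF.
rewrite (GammaE x) -RintegralZl//; apply: le_Rintegral => //.
  exact: (@integrableB _ _ _ leb pos (measurable_itv _) _ _ I2c I3c).
move=> y /=; rewrite in_itv/= andbT => y0.
have cy0 : 0 <= c / y by rewrite divr_ge0 ?ltW.
have := @Bernoulli_powR _ _ (1 + a) cy0; rewrite lerDl => /(_ a0).
rewrite powRM ?(ltW c0) ?invr_ge0 ?(ltW y0)//.
have yi0 : 0 < y^-1 by rewrite invr_gt0.
rewrite !gt0_powRS// Gamma_integrandS// Gamma_integrandD//.
have ya : y `^ a * y^-1 `^ a = 1 by rewrite -powRM ?ltW// divff ?gt_eqF// powR1.
have g0 : 0 <= y * y `^ a / c * Gamma_integrand x y.
  by rewrite !mulr_ge0 ?powR_ge0 ?invr_ge0 ?Gamma_integrand_ge0// ltW.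
move=> /(ler_wpM2r g0); set g := Gamma_integrand x y.
have -> : c * c `^ a * (y^-1 * y^-1 `^ a) * (y * y `^ a / c * g) =
  (y `^ a * y^-1 `^ a) * (c `^ a * g) by field; rewrite !gt_eqF.
rewrite ya mul1r; apply: le_trans.
rewrite le_eqVlt; apply/orP; left; apply/eqP; field; rewrite !gt_eqF//.
Qed.

(** Small exponents a are reduced to 1+a by the functional equation. *)
Lemma Gamma_ge x a : 1 <= x -> 0 <= a ->
  x `^ a * (x / (x + a)) * Gamma x <= Gamma (x + a).
Proof.
move=> x1 a0; have x0 : 0 < x by apply: lt_le_trans x1.
have xa0 : 0 < x + a by rewrite ltr_pwDl.
have := @Gamma_bernoulli_ge x (1 + a) x1; rewrite lerDl => /(_ a0).
rewrite addrCA addrC Gamma_rec; last by rewrite (le_trans x1)// lerDl.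
rewrite gt0_powRS// => H.
rewrite mulrA mulrAC ler_pdivrMr// [leRHS]mulrC (le_trans _ H)//.
by rewrite le_eqVlt; apply/orP; left; apply/eqP; ring.
Qed.

Lemma Gamma1 : Gamma (1 : R) = 1.
Proof.
rewrite GammaE /Rintegral integral_itv_obnd_cbnd; last first.
  by apply/measurable_EFinP; exact: measurable_Gamma_integrand.
rewrite -[RHS]/(fine 1%:E); congr fine; rewrite -[in RHS]invr1 -integral_exp_lin//.
by apply: eq_integral => y _; rewrite /Gamma_integrand subrr powRr0 mul1r mulN1r.
Qed.

Lemma Gamma_gt0 x : 1 <= x -> 0 < Gamma x.
Proof.
move=> x1; have -> : x = 1 + (x - 1) by rewrite addrC subrK.
apply: (lt_le_trans _ (Gamma_ge _ _)); rewrite ?subr_ge0//.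
rewrite Gamma1 mulr1 powR1 !mul1r invr_gt0 addrC subrK.
exact: lt_le_trans x1.
Qed.

End GammaFunction.

(** * Coefficients for the free Bessel laws *)

Section Coefficients.
Context {R : realType}.
Implicit Types (a b r s t q eps : R) (n k i j : nat).

Lemma binom_coef_nd a i j : 1 <= a -> (i <= j)%N ->
  binom_coef a i <= binom_coef a j.
Proof.
move=> a1; elim: j => [|j IH]; first by rewrite leqn0 => /eqP ->.
rewrite leq_eqVlt => /predU1P[->//|]; rewrite ltnS => /IH/le_trans; apply.
rewrite binom_coefS ler_peMr ?binom_coef_ge0//; first by apply: le_trans a1.
by rewrite ler_pdivlMr ?ltr0n// mul1r -natr1 addrC lerD2r.
Qed.

Lemma binom_coef_le a b i : 0 <= a -> a <= b -> binom_coef a i <= binom_coef b i.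
Proof.
move=> a0 ab; apply: ler_prod => j _.
rewrite divr_ge0 ?addr_ge0//= ler_wpM2r ?invr_ge0// lerD2r//.
Qed.

Lemma binom_coef_pred a i : binom_coef a i * (a + i%:R) = a * binom_coef (a + 1) i.
Proof.
rewrite -binom_coef_deriv binom_coefS -mulrA divfK// pnatr_eq0//.
Qed.

Lemma Gamma_binom_coef a k : 1 <= a ->
  Gamma (a + k%:R) = binom_coef a k * k`!%:R * Gamma a.
Proof.
move=> a1; elim: k => [|k IH]; first by rewrite addr0 binom_coef0 fact0 !mul1r.
rewrite -natr1 addrA Gamma_rec; last by rewrite (le_trans a1)// lerDl.
rewrite IH binom_coefS factS natrM; field.
by rewrite nat1r pnatr_eq0.
Qed.

Lemma Gamma_nat k : Gamma (k.+1%:R : R) = k`!%:R.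
Proof.
elim: k => [|k IH]; first by rewrite Gamma1.
by rewrite -natr1 Gamma_rec ?IH ?ler1n// factS natrM.
Qed.

Variables (r s : R).
Hypothesis rs : (0 <= r /\ s = 1) \/ (1 <= r /\ 1 <= s).

Let r0 : 0 <= r.
Proof. by case: rs => -[]// r1 _; apply: le_trans r1. Qed.
Let s1 : 1 <= s.
Proof. by case: rs => -[_]// ->. Qed.
Let s0 : 0 < s.
Proof. exact: lt_le_trans s1. Qed.

Definition bessel_Sigma (w : R) := (1 - w) `^ r / (s - (s - 1) * w).

Definition bessel_ratio := (s - 1) / s.
Local Notation q := bessel_ratio.

Let q0 : 0 <= q. Proof. by rewrite divr_ge0 ?subr_ge0// ltW. Qed.
Let q1 : 1 - q = s^-1. Proof. by rewrite /q; field; rewrite gt_eqF. Qed.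

Lemma bessel_denom w : s - (s - 1) * w = s * (1 - q * w).
Proof. by rewrite /q; field; rewrite gt_eqF. Qed.

Let pos1 (w : R) : w < 0 -> 0 < 1 - w.
Proof. by move=> w0; rewrite subr_gt0 (lt_trans w0). Qed.
Let posq (w : R) : w < 0 -> 0 < 1 - q * w.
Proof. by move=> w0; rewrite subr_gt0 (le_lt_trans _ ltr01)// mulr_ge0_le0// ltW. Qed.

Lemma bessel_Sigma_gt0 w : w < 0 -> 0 < bessel_Sigma w.
Proof.
move=> w0; have p1 := pos1 w0; have pq := posq w0.
by rewrite /bessel_Sigma bessel_denom divr_gt0 ?powR_gt0 ?mulr_gt0.
Qed.

Lemma bessel_Sigma_powE t w : w < 0 ->
  bessel_Sigma w `^ t =
    s `^ (- t) * (1 - 1 * w) `^ (r * t) * (1 - q * w) `^ (- t).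
Proof.
move=> w0; have S0 := bessel_Sigma_gt0 w0; have p1 := pos1 w0; have pq := posq w0.
rewrite mul1r (gt0_powR_expR _ S0) (gt0_powR_expR _ s0) (gt0_powR_expR _ p1).
rewrite (gt0_powR_expR _ pq).
rewrite -!expRD /bessel_Sigma bessel_denom.
rewrite ln_div ?posrE ?powR_gt0 ?mulr_gt0// ln_powR lnM ?posrE//.
by congr expR; ring.
Qed.

Definition bessel_inv_poly t N : {poly R} :=
  s `^ t *: (binom_poly (r * t) 1 N * binom_poly (- t) q N).

Lemma expands_bessel_inv t N :
  expands (fun w => (bessel_Sigma w `^ t)^-1) (bessel_inv_poly t N) N.
Proof.
have := expandsZ (s `^ t)
  (expandsM (expands_binom (r * t) N ler01) (expands_binom (- t) N q0)).
apply: expands_eq; near=> w.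
have w0 : w < 0 by near: w; exact: nbhs_left_lt.
by rewrite -powRN bessel_Sigma_powE// opprK mulrN mulrA.
Unshelve. all: by end_near. Qed.

Lemma expands_bessel t N :
  expands (fun w => bessel_Sigma w `^ t)
    (s `^ (- t) *: (binom_poly (- (r * t)) 1 N * binom_poly t q N)) N.
Proof.
have := expandsZ (s `^ (- t))
  (expandsM (expands_binom (- (r * t)) N ler01) (expands_binom t N q0)).
apply: expands_eq; near=> w.
have w0 : w < 0 by near: w; exact: nbhs_left_lt.
by rewrite bessel_Sigma_powE// opprK mulrA.
Unshelve. all: by end_near. Qed.

(** The two factors of [(1-w)^(-2) Sigma(w)^(-u)]: the expansion of
    [(1-w)^(-b) (1+(s-1)(1-w))^n] with b = 2+ru, and that of
    [(s-(s-1)w)^(-eps)] with eps = n-u in [0,1]. *)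
Definition main_poly n b N : {poly R} :=
  \sum_(i < n.+1) ('C(n, i)%:R * (s - 1) ^+ i) *: binom_poly (b - i%:R) 1 N.
Definition tail_poly eps N : {poly R} := s `^ (- eps) *: binom_poly eps q N.

(** Based on [s-(s-1)w = 1+(s-1)(1-w)]; the integer power n replaces the
    exponent u up to the small exponent n-u. *)
Lemma bessel_coef_factor t n k : (0 < k)%N ->
  let u := k%:R * t in
  eq_modXn k (binom_poly 2 1 k * bessel_inv_poly t k ^+ k)
   (main_poly n (2 + r * u) k * tail_poly (n%:R - u) k).
Proof.
move=> k0 u.
have E1 := expandsM (expands_binom 2 k (@ler01 R)) (expands_exp k (expands_bessel_inv t k)).
apply: (expands_unique E1).
have Em : expands (fun w => \sum_(i < n.+1)
      ('C(n, i)%:R * (s - 1) ^+ i) * (1 - 1 * w) `^ (- (2 + r * u - i%:R)))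
    (main_poly n (2 + r * u) k) k.
  by apply: expands_sum => i; apply: expandsZ; exact: expands_binom.
have Et := expandsZ (s `^ (- (n%:R - u))) (expands_binom (n%:R - u) k q0).
apply: expands_eq (expandsM Em Et); near=> w.
have w0 : w < 0 by near: w; exact: nbhs_left_lt.
have p1 := pos1 w0; have pq := posq w0.
have S1 : 1 + (s - 1) * (1 - w) = s * (1 - q * w) by rewrite -bessel_denom; ring.
transitivity ((1 - w) `^ (- (2 + r * u)) * (s * (1 - q * w)) ^+ n *
   (s `^ (- (n%:R - u)) * (1 - q * w) `^ (- (n%:R - u)))).
  congr (_ * _); rewrite -S1 exprDn mulr_sumr.
  apply: eq_bigr => i _; rewrite expr1n exprMn !mul1r opprB.
  rewrite gt0_powRD// powR_mulrn ?(ltW p1)// -mulr_natl; ring.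
rewrite -powRN bessel_Sigma_powE// mul1r opprK mulrN.
have sq0 : 0 < s * (1 - q * w) by rewrite mulr_gt0.
have P0 : 0 < s `^ t * (1 - w) `^ (- (r * t)) * (1 - q * w) `^ t.
  by rewrite !mulr_gt0 ?powR_gt0.
rewrite -(powR_mulrn n (ltW sq0)) -(powR_mulrn k (ltW P0)).
rewrite (gt0_powR_expR _ P0) !lnM ?posrE ?mulr_gt0 ?powR_gt0// !ln_powR.
rewrite (gt0_powR_expR _ sq0) (gt0_powR_expR _ p1) (gt0_powR_expR _ s0) (gt0_powR_expR _ pq).
rewrite (gt0_powR_expR _ p1) lnM ?posrE// -!expRD; congr expR; rewrite /u; ring.
Unshelve. all: by end_near. Qed.

Lemma main_poly_coef n b N i : (i < N)%N -> (main_poly n b N)`_i =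
  \sum_(m < n.+1) ('C(n, m)%:R * (s - 1) ^+ m) * binom_coef (b - m%:R) i.
Proof.
move=> iN; rewrite coef_sum; apply: eq_bigr => m _.
by rewrite coefZ coef_poly iN expr1n mulr1.
Qed.

Section MainCoef.
Variables (n : nat) (u : R).
Hypothesis un : n%:R - 1 <= u <= n%:R.
Hypothesis u0 : 0 <= u.
Let b := 2 + r * u.

(* In the second case r >= 1 keeps every exponent b - m at least 1; in the
   first, only the term m = 0 survives. *)
Let term_ge1 m : (m <= n)%N -> s - 1 = 0 \/ 1 <= b - m%:R.
Proof.
move=> mn; case: rs => [[_ ->]|[r1 _]]; first by left; rewrite subrr.
right; rewrite /b; have : u <= r * u by rewrite ler_peMl.
have : m%:R <= n%:R :> R by rewrite ler_nat.
by case/andP: un => + _; lra.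
Qed.

Let w_ m := 'C(n, m)%:R * (s - 1) ^+ m.
Let w_ge0 m : 0 <= w_ m.
Proof. by rewrite mulr_ge0// exprn_ge0// subr_ge0. Qed.

Lemma main_coef_nd N i j : (i <= j)%N -> (j < N)%N ->
  (main_poly n b N)`_i <= (main_poly n b N)`_j.
Proof.
move=> ij jN; rewrite !main_poly_coef//; last exact: leq_ltn_trans jN.
apply: ler_sum => m _; have [s10|b1] := @term_ge1 m (ltn_ord m).
  rewrite -/(w_ m) /w_ s10; case: (m : nat) => [|m']; last by rewrite expr0n mulr0 !mul0r.
  rewrite expr0 mulr1 bin0 !mul1r subr0 binom_coef_nd// /b (@le_trans _ _ 2)//.
    by rewrite ler1n.
  by rewrite lerDl mulr_ge0.
by rewrite ler_wpM2l ?w_ge0// binom_coef_nd.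
Qed.

Lemma main_coef_ge N i : (i < N)%N -> binom_coef b i <= (main_poly n b N)`_i.
Proof.
move=> iN; rewrite main_poly_coef// big_ord_recl/= bin0 expr0 !mul1r subr0 lerDl.
apply: sumr_ge0 => m _; have [s10|b1] := @term_ge1 (bump 0 m) (ltn_ord m).
  by rewrite s10 /bump add1n expr0n mulr0 mul0r.
by rewrite mulr_ge0 ?w_ge0// binom_coef_ge0// (le_trans _ b1).
Qed.

(** Lowering the exponent from b to b-1 divides the i-th coefficient by
    (b-1+i)/(b-1), so all the terms but the first are O(1/i). *)
Lemma main_coef_le N i : (i < N)%N -> (main_poly n b N)`_i <=
  binom_coef b i * (1 + s ^+ n * ((1 + r * n%:R) / i.+1%:R)).
Proof.
move=> iN; rewrite main_poly_coef// big_ord_recl/= bin0 expr0 !mul1r subr0 mulrDr mulr1 lerD2l.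
have b1 : 1 <= b - 1 by rewrite /b; have := mulr_ge0 r0 u0; lra.
have bi0 : 0 <= binom_coef b i by rewrite binom_coef_ge0//; lra.
set T := (1 + r * n%:R) / i.+1%:R.
have bT : binom_coef (b - 1) i <= binom_coef b i * T.
  have := binom_coef_pred (b - 1) i; rewrite subrK => E.
  have bp : 0 < b - 1 + i%:R by rewrite ltr_pwDl// (lt_le_trans _ b1).
  rewrite -(ler_pM2r bp) E mulrC -mulrA ler_wpM2l//.
  rewrite /T mulrAC ler_pdivlMr ?ltr0n//.
  have H : b - 1 <= 1 + r * n%:R.
    have : r * u <= r * n%:R by rewrite ler_wpM2l//; case/andP: un.
    by rewrite /b; lra.
  rewrite ler_pM//; first by lra.
  by rewrite -natr1; lra.
have T0 : 0 <= T by rewrite divr_ge0// addr_ge0// mulr_ge0.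
apply: (@le_trans _ _ (\sum_(m < n) w_ m.+1 * (binom_coef b i * T))).
  apply: ler_sum => m _; rewrite /bump add1n -/(w_ m.+1).
  have [s10|bm] := @term_ge1 m.+1 (ltn_ord m).
    by rewrite /w_ s10 expr0n mulr0 !mul0r.
  rewrite ler_wpM2l ?w_ge0// (le_trans _ bT)// binom_coef_le//; first by lra.
  by rewrite lerD2l lerN2 ler1n.
rewrite -mulr_suml [leRHS]mulrCA ler_wpM2r ?(mulr_ge0 bi0 T0)//.
have -> : s ^+ n = \sum_(m < n.+1) w_ m.
  rewrite -[s in LHS](subrK 1) addrC exprDn; apply: eq_bigr => m _.
  by rewrite expr1n mul1r /w_ mulr_natl.
by rewrite big_ord_recl/= lerDr.
Qed.

End MainCoef.

Section TailCoef.
Variables (eps : R).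
Hypothesis eps0 : 0 <= eps.

Lemma tail_coef_ge0 N i : 0 <= (tail_poly eps N)`_i.
Proof.
rewrite coefZ coef_poly; case: ifPn => _; last by rewrite mulr0.
by rewrite mulr_ge0 ?powR_ge0// mulr_ge0 ?binom_coef_ge0// exprn_ge0.
Qed.

Lemma tail_coef0 N : (0 < N)%N -> (tail_poly eps N)`_0 = s `^ (- eps).
Proof. by move=> N0; rewrite coefZ coef_poly N0 binom_coef0 expr0 !mulr1. Qed.

(** The coefficients sum to the value at w = 1, which is 1. *)
Lemma tail_coef_sum N : \sum_(i < N) (tail_poly eps N)`_i <= 1.
Proof.
have qlt : q * 1 < 1 by rewrite mulr1 -subr_gt0 q1 invr_gt0.
have := binom_poly_le N eps0 q0 ler01 qlt.
rewrite mulr1 q1 -(ler_pM2l (powR_gt0 (- eps) s0)) -powRM ?invr_ge0 ?(ltW s0)//.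
rewrite divff ?gt_eqF// powR1; apply: le_trans.
rewrite horner_poly mulr_sumr; apply: ler_sum => i _.
by rewrite coefZ coef_poly ltn_ord expr1n mulr1.
Qed.

End TailCoef.

(** The coefficient is a convolution of [main_poly] with nonnegative weights of
    total mass at most 1.  Monotonicity of the coefficients of [main_poly]
    bounds it above by the last one; keeping the weight at 0 bounds it below. *)
Lemma bessel_coef_bounds n t k : (0 < k)%N ->
  let u := k%:R * t in n%:R - 1 <= u <= n%:R -> 0 <= u ->
  let B := binom_coef (2 + r * u) k.-1 in
  let m := (binom_poly 2 1 k * bessel_inv_poly t k ^+ k)`_k.-1 in
  s `^ (u - n%:R) * B <= m /\ m <= B * (1 + s ^+ n * ((1 + r * n%:R) / k%:R)).
Proof.
move=> k0 u un u0 B m.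
have e0 : 0 <= n%:R - u by case/andP: un => _; rewrite subr_ge0.
have kk : (k.-1 < k)%N by rewrite prednK.
rewrite /m (eq_modXn_coef (bessel_coef_factor t n k0) kk) -/u coefMr prednK//.
split.
  rewrite (bigD1 (Ordinal k0))//= subn0 tail_coef0// opprB mulrC.
  rewrite -[leLHS]addr0 lerD//.
    by rewrite ler_wpM2r ?powR_ge0// main_coef_ge.
  apply: sumr_ge0 => i _; rewrite mulr_ge0 ?tail_coef_ge0//.
  rewrite (le_trans _ (main_coef_ge un u0 _))//.
    by rewrite binom_coef_ge0// addr_ge0// mulr_ge0.
  by rewrite (leq_ltn_trans (leq_subr _ _)).
apply: (le_trans _ (_ : B * (1 + s ^+ n * ((1 + r * n%:R) / k%:R)) * 1 <= _)); last by rewrite mulr1.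
have := main_coef_le un u0 kk; rewrite (prednK k0) => main_le.
apply: (@le_trans _ _ (\sum_(i < k)
  (main_poly n (2 + r * u) k)`_k.-1 * (tail_poly (n%:R - u) k)`_i)).
  apply: ler_sum => i _; rewrite ler_wpM2r ?tail_coef_ge0//.
  by apply: main_coef_nd => //; exact: leq_subr.
rewrite -mulr_sumr ler_pM//.
- by rewrite (le_trans _ (main_coef_ge un u0 _))// binom_coef_ge0// addr_ge0// mulr_ge0.
- by apply: sumr_ge0 => i _; exact: tail_coef_ge0.
- exact: tail_coef_sum.
Qed.

End Coefficients.

(** * The limit of the rescaled moments *)

Lemma scaled_moment_squeeze {R : realType} (X b m S c ua g G P Q rho e1 e2 : R) :
  0 <= X -> 0 <= S -> 0 <= c -> 0 <= ua -> 0 < g -> 0 < G -> 0 <= P -> 0 <= e1 ->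
  P * g <= G -> G <= Q * g -> e1 <= rho -> rho <= e2 ->
  X * b = ua / g * rho -> S * b <= m -> m <= b * (1 + c) ->
  S * (ua * P / G * e1) <= X * m <= ua * Q / G * e2 * (1 + c).
Proof.
move=> X0 S0 c0 ua0 g0 G0 P0 e0 PG GQ r1 r2 XB m1 m2.
have i1 : P / G <= g^-1 by rewrite ler_pdivrMr// [leRHS]mulrC ler_pdivlMr.
have i2 : g^-1 <= Q / G by rewrite ler_pdivlMr// [leLHS]mulrC ler_pdivrMr.
have gi0 : 0 <= g^-1 by rewrite invr_ge0 ltW.
have PG0 : 0 <= P / G by rewrite divr_ge0// ltW.
apply/andP; split.
  apply: (le_trans _ (ler_wpM2l X0 m1)).
  rewrite [leRHS]mulrCA ler_wpM2l// XB -!mulrA ler_wpM2l// mulrA.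
  exact: ler_pM.
apply: (le_trans (ler_wpM2l X0 m2)).
rewrite mulrA ler_wpM2r ?addr_ge0// XB -!mulrA ler_wpM2l// mulrA.
by apply: ler_pM => //; exact: le_trans r1.
Qed.

Section ScaledMoments.
Context {R : realType}.
Variables (r s : R).
Hypothesis rs : (0 <= r /\ s = 1) \/ (1 <= r /\ 1 <= s).

Let r0 : 0 <= r.
Proof. by case: rs => -[]// r1 _; apply: le_trans r1. Qed.
Let s0 : 0 < s.
Proof. by case: rs => -[_]; [move=> ->|exact: lt_le_trans]. Qed.

(** The law of [t^r X^(1/t)] has explicit moments only at the multiples of t;
    [root_exponent n t] is the largest one not exceeding n, and it corresponds to
    the moment of X of order [root_index n t]. *)
Definition root_index n (t : R) := Num.truncn (n%:R / t).
Definition root_exponent n (t : R) := (root_index n t)%:R * t.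

Lemma root_exponent_bounds n (t : R) : 0 < t -> n%:R - t <= root_exponent n t <= n%:R.
Proof.
move=> t0; have nt : 0 <= n%:R / t by rewrite divr_ge0// ltW.
have /andP[h1 h2] := truncn_itv nt; rewrite /root_exponent /root_index; apply/andP; split.
  rewrite lerBlDr -[X in _ + X]mul1r -mulrDl natr1.
  by rewrite -ler_pdivrMr// ltW.
by rewrite -ler_pdivlMr.
Qed.

Lemma cvg_root_exponent n : root_exponent n t @[t --> (0:R)^'+] --> (n%:R : R).
Proof.
apply: (@squeeze_cvgr _ _ _ _ (fun t => n%:R - t) (fun=> n%:R)).
- near=> t; apply: root_exponent_bounds; near: t; exact: nbhs_right_gt.
- rewrite -[X in _ --> X]subr0; apply: cvgB; first exact: cvg_cst.
  by apply: cvg_at_right_filter; exact: cvg_id.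
- exact: cvg_cst.
Unshelve. all: by end_near. Qed.

Lemma root_index_gt0 n t : 0 < t -> t < 1 -> (0 < n)%N -> (0 < root_index n t)%N.
Proof.
move=> t0 t1 n0; have /andP[h _] := root_exponent_bounds n t0.
rewrite lt0n; apply/eqP => k0; move: h; rewrite /root_exponent k0 mul0r subr_le0.
by rewrite leNgt (lt_le_trans t1)// ler1n.
Qed.

Definition bessel_moment t k : R :=
  (binom_poly 2 1 k * bessel_inv_poly r s t k ^+ k)`_k.-1 / k%:R.

(** The two sides are arranged so that, when k t has a limit and t tends to 0,
    only the last factor, which tends to 1, still involves k. *)
Lemma scaled_binom_coef (k : nat) (a t : R) : (0 < k)%N -> 0 <= a -> 0 < t ->
  t `^ a * (binom_coef (2 + a) k.-1 / k%:R) =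
  (k%:R * t) `^ a / Gamma (2 + a) * (Gamma (k.+1%:R + a) / (Gamma (k.+1%:R) * k%:R `^ a)).
Proof.
move=> k0 a0 t0; have a2 : 1 <= 2 + a by lra.
have G2 := Gamma_gt0 a2.
have kR : 0 < k%:R :> R by rewrite ltr0n.
have -> : k.+1%:R + a = 2 + a + k.-1%:R :> R.
  by rewrite -[in LHS](prednK k0) -!natr1; ring.
rewrite Gamma_binom_coef// Gamma_nat -[in k`!](prednK k0) factS prednK// natrM.
rewrite powRM ?ltW//; field.
rewrite !gt_eqF ?powR_gt0 ?ltr0n ?fact_gt0//.
Qed.

Lemma Gamma_ratio_bounds (k : nat) (a : R) : (0 < k)%N -> 0 <= a ->
  (1 + (1 + a) / k%:R)^-1 <= Gamma (k.+1%:R + a) / (Gamma (k.+1%:R) * k%:R `^ a)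
   <= (1 + (1 + a) / k%:R) `^ a.
Proof.
move=> k0 a0; have k1 : 1 <= k.+1%:R :> R by rewrite ler1n.
have kR : 0 < k%:R :> R by rewrite ltr0n.
have Gk := Gamma_gt0 k1; have ka := powR_gt0 a kR.
have E : 1 + (1 + a) / k%:R = (k.+1%:R + a) / k%:R.
  by rewrite -natr1; field; rewrite gt_eqF.
apply/andP; split; last first.
  rewrite ler_pdivrMr ?mulr_gt0// (le_trans (Gamma_bernoulli_le k1 a0))//.
  rewrite E mulrCA mulrC ler_wpM2l ?(ltW Gk)//.
  by rewrite -powRM ?divfK ?gt_eqF ?(ltW kR)// divr_ge0// addr_ge0.
rewrite ler_pdivlMr ?mulr_gt0//; apply: le_trans (Gamma_ge k1 a0).
rewrite E invf_div mulrCA mulrC ler_wpM2r ?(ltW Gk)// mulrC.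
rewrite ler_pM ?(ltW ka)//.
- by rewrite divr_ge0// addr_ge0.
- by rewrite ge0_ler_powR ?nnegrE// ler_nat.
- by rewrite ler_wpM2r ?invr_ge0 ?addr_ge0// ler_nat.
Qed.

Lemma cvg_scaled_bessel_moment n : (0 < n)%N ->
  t `^ (r * root_exponent n t) * bessel_moment t (root_index n t)
    @[t --> (0:R)^'+] --> (n%:R : R) `^ (r * n%:R) / Gamma (2 + r * n%:R).
Proof.
move=> n0; pose u t := root_exponent n t; pose k t := root_index n t.
pose a t := r * u t; pose d t := r * (n%:R - u t).
pose G : R := Gamma (2 + r * n%:R).
pose e t := 1 + (1 + a t) * (t / u t).
pose C := s ^+ n * (1 + r * n%:R).
(* d t is the distance from 2 + a t to its limit 2 + r n; instead of the
   continuity of Gamma, the bounds of [Gamma_ge] and [Gamma_bernoulli_le] on the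
   ratio of its values at these two points are used *)
pose lo t := s `^ (u t - n%:R) *
  (u t `^ a t * ((2 + a t) `^ d t * ((2 + a t) / (2 + a t + d t))) / G * (e t)^-1).
pose hi t := u t `^ a t * (2 + a t + d t) `^ d t / G * e t `^ a t * (1 + C * (t / u t)).
have cu : u t @[t --> (0:R)^'+] --> (n%:R : R) by exact: cvg_root_exponent.
have nR : 0 < n%:R :> R by rewrite ltr0n.
have ca : a t @[t --> (0:R)^'+] --> r * n%:R by apply: cvgM => //; exact: cvg_cst.
have cd : d t @[t --> (0:R)^'+] --> 0.
  have : d t @[t --> (0:R)^'+] --> r * (n%:R - n%:R).
    by apply: cvgM; [exact: cvg_cst|apply: cvgB => //; exact: cvg_cst].
  by rewrite subrr mulr0.
have ctu : t / u t @[t --> (0:R)^'+] --> 0.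
  have : t / u t @[t --> (0:R)^'+] --> 0 / (n%:R : R); last by rewrite mul0r.
  apply: cvgM.
    by apply: cvg_at_right_filter; exact: cvg_id.
  by apply: cvgV => //; rewrite gt_eqF.
have ce : e t @[t --> (0:R)^'+] --> (1 : R).
  have : e t @[t --> (0:R)^'+] --> 1 + (1 + r * n%:R) * 0; last by rewrite mulr0 addr0.
  apply: cvgD; first exact: cvg_cst.
  by apply: cvgM => //; apply: cvgD => //; exact: cvg_cst.
have ca2 : 2 + a t @[t --> (0:R)^'+] --> (2 + r * n%:R : R).
  by apply: cvgD => //; exact: cvg_cst.
have a2 : 0 < 2 + r * n%:R by rewrite ltr_pwDl// mulr_ge0// ltW.
apply: (@squeeze_cvgr _ _ _ _ lo hi).
- near=> t.
  have t0 : 0 < t by near: t; exact: nbhs_right_gt.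
  have t1 : t < 1 by near: t; exact: nbhs_right_lt.
  have /andP[un1 un2] := root_exponent_bounds n t0.
  have k0 : (0 < k t)%N by exact: root_index_gt0.
  have u0 : 0 < u t by rewrite mulr_gt0 ?ltr0n.
  have a0 : 0 <= a t by rewrite mulr_ge0// ltW.
  have d0 : 0 <= d t by rewrite mulr_ge0// subr_ge0.
  have [] := @bessel_coef_bounds _ r s rs n t (k t) k0.
  + by rewrite -/(root_exponent n t) un2 andbT; lra.
  + by rewrite -/(root_exponent n t) ltW.
  rewrite -/(root_exponent n t) -/(u t) -/(a t) => B1 B2.
  have kR : 0 < (k t)%:R :> R by rewrite ltr0n.
  have tk : t / u t = (k t)%:R^-1.
    by rewrite /u /root_exponent -/(k t); field; rewrite !gt_eqF.
  have /andP[rho1 rho2] := Gamma_ratio_bounds k0 a0; rewrite -tk -/(e t) in rho1 rho2.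
  have := scaled_binom_coef k0 a0 t0; rewrite -/(u t).
  move: rho1 rho2; set rho := Gamma _ / _ => rho1 rho2 XB.
  have x1 : 1 <= 2 + a t by lra.
  have G0 := Gamma_gt0 x1.
  have GE : G = Gamma (2 + a t + d t) by rewrite /G /a /d; congr Gamma; ring.
  have G1 : 0 < G by rewrite GE Gamma_gt0//; lra.
  have H1 := Gamma_ge x1 d0; rewrite -GE in H1.
  have H2 := Gamma_bernoulli_le x1 d0; rewrite -GE in H2.
  have ua := powR_ge0 (u t) (a t).
  have e0 : 0 < e t by rewrite /e ltr_pwDl// mulr_ge0 ?divr_ge0 ?addr_ge0// ltW.
  have m1 : s `^ (u t - n%:R) * (binom_coef (2 + a t) (k t).-1 / (k t)%:R) <=
      bessel_moment t (k t).
    by rewrite /bessel_moment mulrA; apply: ler_wpM2r B1; rewrite invr_ge0.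
  have m2 : bessel_moment t (k t) <=
      binom_coef (2 + a t) (k t).-1 / (k t)%:R * (1 + C * (t / u t)).
    rewrite /bessel_moment mulrAC tk.
    apply: ler_wpM2r; first by rewrite invr_ge0.
    by rewrite (le_trans B2)// /C mulrA.
  have c0 : 0 <= C * (t / u t).
    rewrite mulr_ge0 ?divr_ge0 ?(ltW t0) ?(ltW u0)//.
    by rewrite mulr_ge0 ?exprn_ge0 ?(ltW s0)// addr_ge0// mulr_ge0.
  have P0 : 0 <= (2 + a t) `^ d t * ((2 + a t) / (2 + a t + d t)).
    apply: mulr_ge0; first exact: powR_ge0.
    by apply: divr_ge0; rewrite ?addr_ge0.
  have ei0 : 0 <= (e t)^-1 by rewrite invr_ge0 ltW.
  exact: (scaled_moment_squeeze (powR_ge0 t (a t)) (powR_ge0 s (u t - n%:R))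
    c0 ua G0 G1 P0 ei0 H1 H2 rho1 rho2 XB m1 m2).
- have -> : (n%:R : R) `^ (r * n%:R) / G = s `^ (n%:R - n%:R) * (n%:R `^ (r * n%:R) *
    ((2 + r * n%:R) `^ 0 * ((2 + r * n%:R) / (2 + r * n%:R + 0))) / G * 1^-1).
    by rewrite subrr !powRr0 addr0 divff ?gt_eqF// !mul1r mulr1 invr1 mulr1.
  apply: cvgM.
    apply: cvg_powR => //; first exact: cvg_cst.
    by apply: cvgB => //; exact: cvg_cst.
  apply: cvgM; last by apply: cvgV => //; rewrite oner_neq0.
  apply: cvgM; last exact: cvg_cst.
  apply: cvgM; first exact: cvg_powR.
  apply: cvgM; first exact: cvg_powR.
  apply: cvgM => //; apply: cvgV; first by rewrite addr0 gt_eqF.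
  exact: cvgD.
- have -> : (n%:R : R) `^ (r * n%:R) / G = n%:R `^ (r * n%:R) *
    (2 + r * n%:R + 0) `^ 0 / G * 1 `^ (r * n%:R) * (1 + C * 0).
    by rewrite powRr0 powR1 mulr0 addr0 !mulr1.
  apply: cvgM.
    apply: cvgM.
      apply: cvgM; last exact: cvg_cst.
      apply: cvgM; first exact: cvg_powR.
      apply: cvg_powR => //; first by rewrite addr0.
      exact: cvgD.
    exact: cvg_powR.
  apply: cvgD; first exact: cvg_cst.
  by apply: cvgM => //; exact: cvg_cst.
Unshelve. all: by end_near. Qed.

End ScaledMoments.

(** * The free Poisson law *)

Section FreePoisson.
Context {R : realType}.
Implicit Types (p : law R) (x y z w : R).
Local Notation leb := (@lebesgue_measure R).
Local Notation nneg := (`[0%R, +oo[%classic : set (measurableTypeR R)).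

(** By uniqueness, the Radon-Nikodym derivative of p is f on D, 0 elsewhere. *)
Lemma integral_density p (D : set (measurableTypeR R)) (f : R -> R) (g : R -> \bar R) :
  measurable D -> measurable_fun D f -> (forall x, D x -> 0 <= f x) ->
  (forall A, measurable A -> p A = (\int[leb]_(x in A `&` D) (f x)%:E)%E) ->
  measurable_fun setT g -> (forall x, (0 <= g x)%E) ->
  (\int[p]_x g x = \int[leb]_(x in D) (g x * (f x)%:E))%E.
Proof.
move=> mD mf f0 pE mg g0.
pose h : R -> \bar R := (EFin \o f) \_ D.
have mh : measurable_fun setT h.
  by apply/(measurable_restrictT _ mD); exact/measurable_EFinP.
have h0 x : (0 <= h x)%E.
  by rewrite /h patchE; case: ifPn => // /set_mem xD; rewrite lee_fin f0.
have pEh A : measurable A -> p A = (\int[leb]_(x in A) h x)%E.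
  by move=> mA; rewrite pE// integral_mkcondr.
have dom : p `<< leb.
  apply/null_content_dominatesP => A mA A0; rewrite pEh//.
  by apply: null_set_integral => //; exact: measurable_funTS.
have ih : leb.-integrable setT h.
  apply/integrableP; split => //.
  under eq_integral do rewrite gee0_abs//.
  by rewrite -pEh// probability_setT ltry.
have := Radon_Nikodym_SigmaFinite.change_of_variables dom g0 measurableT mg.
move=> <-; rewrite [RHS]integral_mkcond.
apply: ae_eq_integral => //.
- apply: emeasurable_funM => //.
  exact: measurable_int (Radon_Nikodym_SigmaFinite.f_integrable dom).
- apply/(measurable_restrictT _ mD); apply: emeasurable_funM.
    exact: measurable_funTS.
  exact/measurable_EFinP.
- have : ae_eq leb setT (Radon_Nikodym_SigmaFinite.f p leb) h.
    apply: integral_ae_eq => //.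
      exact: Radon_Nikodym_SigmaFinite.f_integrable.
    by move=> A _ mA; rewrite -pEh// -Radon_Nikodym_SigmaFinite.f_integral.
  apply: filterS => x /(_ I) H _; rewrite H /h !patchE.
  by case: ifPn => // _; rewrite mule0.
Qed.

(** The substitution v = sqrt((4-x)/x) maps ]0,4[ onto ]0,+oo[ and makes the
    free Poisson density rational. *)
Definition poisson_slope x := Num.sqrt ((4 - x) / x).
Definition poisson_kappa z := Num.sqrt ((z - 4) / z).
Local Notation vv := poisson_slope.

(** A primitive of [density(x) / (x-z)], by partial fractions in v; it vanishes
    at x = 4. *)
Definition poisson_primitive z x :=
  pi^-1 * (atan (vv x) - poisson_kappa z * atan ((poisson_kappa z)^-1 * vv x)).

Lemma poisson_kappa_gt0 z : z < 0 -> 0 < poisson_kappa z.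
Proof.
move=> z0; rewrite sqrtr_gt0 -[X in 0 < X]mulrNN mulr_gt0//.
  by rewrite oppr_gt0; lra.
by rewrite oppr_gt0 invr_lt0.
Qed.

Lemma poisson_kappa_sqr z : z < 0 -> poisson_kappa z ^+ 2 = (z - 4) / z.
Proof.
move=> z0; rewrite sqr_sqrtr// -[X in 0 <= X]mulrNN mulr_ge0//.
  by rewrite oppr_ge0; lra.
by rewrite oppr_ge0 invr_le0 ltW.
Qed.

Lemma poisson_densityE x : 0 < x -> x <= 4 ->
  free_poisson_density x = vv x / (2 * pi).
Proof.
move=> x0 x4; rewrite /free_poisson_density /vv.
have -> : x * (4 - x) = x ^+ 2 * ((4 - x) / x) by field; rewrite gt_eqF.
rewrite sqrtrM ?sqr_ge0// sqrtr_sqr gtr0_norm//.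
have := pi_gt0 R; move: (@pi R) => P P0; field.
by rewrite !gt_eqF.
Qed.

Lemma is_derive_poisson_slope x : 0 < x -> x < 4 ->
  is_derive x 1 vv (- 2 / (x ^+ 2 * vv x)).
Proof.
move=> x0 x4; have p0 : 0 < (4 - x) / x by rewrite divr_gt0 ?subr_gt0.
have D1 : is_derive x 1 (fun x => (4 - x) / x) (- 4 / x ^+ 2).
  have D2 : is_derive x 1 (fun x : R => x^-1) (- x ^- 2).
    apply: (is_derive_eq (@is_deriveV _ id x _ 1 (lt0r_neq0 x0) (is_derive_id x 1))).
    exact: mulr1.
  have D3 : is_derive x 1 (fun x : R => 4 - x) (-1).
    apply: (is_derive_eq (is_deriveB (is_derive_cst (4 : R) x 1) (is_derive_id x 1))).
    exact: sub0r.
  apply: (is_derive_eq (is_deriveM D3 D2)).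
  rewrite -[LHS]/((4 - x) * - x ^- 2 + x^-1 * -1); field.
  by rewrite gt_eqF.
have D4 := @is_derive1_comp R (@Num.sqrt R) (fun x => (4 - x) / x) x _ _
  (is_derive1_sqrt p0) D1.
apply: (is_derive_eq D4).
rewrite -/(vv x); have v0 : 0 < vv x by rewrite sqrtr_gt0.
by field; rewrite !gt_eqF.
Qed.

Lemma is_derive_poisson_primitive z x : z < 0 -> 0 < x -> x < 4 ->
  is_derive x 1 (poisson_primitive z) (free_poisson_density x / (x - z)).
Proof.
move=> z0 x0 x4; have Dv := is_derive_poisson_slope x0 x4.
have k0 := poisson_kappa_gt0 z0; set k := poisson_kappa z in k0 *.
have D1 := is_derive1_comp (is_derive1_atan (vv x)) Dv.
have Dk := is_deriveZ k^-1 Dv.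
have D2 := @is_derive1_comp R (@atan R) (fun x => k^-1 * vv x) x _ _
  (is_derive1_atan (k^-1 * vv x)) Dk.
have D3 := is_deriveZ pi^-1 (is_deriveB D1 (is_deriveZ k D2)).
apply: (is_derive_eq D3).
rewrite poisson_densityE//; last exact: ltW.
set v := vv x; set dv := - 2 / _.
rewrite -[LHS]/(pi^-1 *
  ((1 + v ^+ 2)^-1 * dv - k * ((1 + (k^-1 * v) ^+ 2)^-1 * (k^-1 * dv)))).
have v0 : 0 < v by rewrite sqrtr_gt0 divr_gt0// subr_gt0.
have v2 : v ^+ 2 = (4 - x) / x by rewrite sqr_sqrtr// divr_ge0 ?subr_ge0// ltW.
have k2 : k ^+ 2 = (z - 4) / z by exact: poisson_kappa_sqr.
have zn : z != 0 by rewrite lt_eqF.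
have xn : x != 0 by rewrite gt_eqF.
have x4n : 4 - x != 0 by rewrite subr_eq0 gt_eqF.
have zx : z - x != 0 by rewrite subr_eq0 lt_eqF// (lt_trans z0).
have E1 : (1 + v ^+ 2)^-1 = x / 4.
  have -> : 1 + v ^+ 2 = 4 / x by rewrite v2; field.
  by rewrite invf_div.
have E2 : k * ((1 + (k^-1 * v) ^+ 2)^-1 * (k^-1 * dv)) =
    x * (z - 4) / (4 * (z - x)) * dv.
  have -> : k * ((1 + (k^-1 * v) ^+ 2)^-1 * (k^-1 * dv)) = k ^+ 2 / (k ^+ 2 + v ^+ 2) * dv.
    have kn : k != 0 by rewrite gt_eqF.
    have kv : k ^+ 2 + v ^+ 2 != 0 by rewrite gt_eqF// addr_gt0 ?exprn_gt0.
    by field; rewrite ?kn ?kv.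
  have -> : k ^+ 2 + v ^+ 2 = 4 * (z - x) / (z * x) by rewrite k2 v2; field; rewrite xn zn.
  by congr (_ * _); rewrite k2; field; rewrite xn zn zx.
have E3 : dv = - 2 * v / (x * (4 - x)).
  have -> : 4 - x = v ^+ 2 * x by rewrite v2 divfK.
  by rewrite /dv -/v; field; rewrite xn gt_eqF.
rewrite E1 E2 E3; have := pi_gt0 R; move: (@pi R) => P P0.
have Pn : P != 0 by rewrite gt_eqF.
have xz : x - z != 0 by rewrite -opprB oppr_eq0.
by field; do ?[apply/andP; split].
Qed.

Lemma continuous_poisson_slope x : 0 < x -> {for x, continuous vv}.
Proof.
move=> x0; apply: (@continuous_comp _ _ _ (fun x => (4 - x) / x) (@Num.sqrt R)).
  apply: cvgM; first by apply: cvgB; [exact: cvg_cst|exact: cvg_id].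
  by apply: cvgV; [rewrite gt_eqF|exact: cvg_id].
exact: sqrt_continuous.
Qed.

Lemma continuous_poisson_primitive z x : 0 < x ->
  {for x, continuous (poisson_primitive z)}.
Proof.
move=> x0; have cv := continuous_poisson_slope x0.
apply: cvgM; first exact: cvg_cst.
apply: cvgB.
  by apply: (@continuous_comp _ _ _ vv (@atan R)) => //; exact: continuous_atan.
apply: cvgM; first exact: cvg_cst.
apply: (@continuous_comp _ _ _ (fun x => (poisson_kappa z)^-1 * vv x) (@atan R)).
  by apply: cvgM => //; exact: cvg_cst.
exact: continuous_atan.
Qed.

Lemma measurable_free_poisson_density : measurable_fun setT (@free_poisson_density R).
Proof.
apply: measurable_funM.
  apply: measurableT_comp; first by apply: continuous_measurable_fun; exact: sqrt_continuous.
  by apply: measurable_funM => //; exact: measurable_funB.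
by apply: (measurableT_comp measurable_inv); exact: measurable_funM.
Qed.

Lemma free_poisson_density_ge0 x : 0 <= x -> 0 <= free_poisson_density x.
Proof. by move=> x0; rewrite divr_ge0 ?sqrtr_ge0// !mulr_ge0// pi_ge0. Qed.

(** The density is unbounded at 0, so the fundamental theorem of calculus is
    applied on the intervals [a_n, 4], where [poisson_slope a_n = n+1], and the
    integrals increase to the one wanted. *)
Lemma integral_poisson_kernel z : z < 0 ->
  (\int[leb]_(x in `]0%R, 4%R[) ((x - z)^-1 * free_poisson_density x)%:E =
    ((poisson_kappa z - 1) / 2)%:E)%E.
Proof.
move=> z0.
pose a (n : nat) : R := 4 / (1 + n.+1%:R ^+ 2).
have a0 n : 0 < a n by rewrite divr_gt0// ltr_pwDl// sqr_ge0.
have a4 n : a n < 4.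
  by rewrite ltr_pdivrMr ?ltr_pwDl ?sqr_ge0// ltr_pMr// ltrDl exprn_gt0.
have va n : vv (a n) = n.+1%:R.
  rewrite /vv /a -[RHS]ger0_norm// -sqrtr_sqr; congr Num.sqrt.
  have : 1 + n.+1%:R ^+ 2 != 0 :> R by rewrite gt_eqF// ltr_pwDl// sqr_ge0.
  by move=> ?; field.
pose f x := (x - z)^-1 * free_poisson_density x.
have cf x : 0 < x -> {for x, continuous f}.
  move=> x0; apply: cvgM.
    apply: cvgV; first by rewrite subr_eq0 gt_eqF// (lt_trans z0).
    by apply: cvgB; [exact: cvg_id|exact: cvg_cst].
  apply: cvgM.
    apply: (@continuous_comp _ _ _ (fun x => x * (4 - x)) (@Num.sqrt R)).
      apply: cvgM; first exact: cvg_id.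
      by apply: cvgB; [exact: cvg_cst|exact: cvg_id].
    exact: sqrt_continuous.
  apply: cvgV; first by rewrite gt_eqF// !mulr_gt0// pi_gt0.
  by apply: cvgM; [exact: cvg_cst|exact: cvg_id].
have step n : (\int[leb]_(x in `[a n, 4%R]) (f x)%:E =
    (poisson_primitive z 4)%:E - (poisson_primitive z (a n))%:E)%E.
  apply: continuous_FTC2 => //.
  - apply: continuous_in_subspaceT => x; rewrite inE/= in_itv/= => /andP[ax _].
    by apply: cf; exact: lt_le_trans ax.
  - split.
    + move=> x; rewrite in_itv/= => /andP[ax x4]; apply: ex_derive.
      by apply: is_derive_poisson_primitive => //; exact: lt_trans ax.
    + by apply: cvg_at_right_filter; exact: continuous_poisson_primitive.
    + by apply: cvg_at_left_filter; exact: continuous_poisson_primitive.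
  - move=> x; rewrite in_itv/= => /andP[ax x4]; rewrite derive1E /f mulrC.
    by apply: derive_val; apply: is_derive_poisson_primitive => //; exact: lt_trans ax.
have mf (D : set R) : measurable_fun D f.
  apply: measurable_funTS; apply: measurable_funM; last exact: measurable_free_poisson_density.
  by apply: (measurableT_comp measurable_inv); exact: measurable_funB.
have f0 x : 0 < x -> 0 <= f x.
  move=> x0; rewrite mulr_ge0 ?free_poisson_density_ge0 ?ltW//.
  by rewrite invr_gt0 subr_gt0 (lt_trans z0).
have L1 : (\int[leb]_(x in `[a n, 4%R]) (f x)%:E)%E @[n --> \oo] -->
    (\int[leb]_(x in `]0%R, 4%R]) (f x)%:E)%E.
  have -> : `]0%R, 4%R]%classic = \bigcup_n `[a n, 4%R]%classic.
    apply/seteqP; split => x /=; rewrite in_itv/=.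
      move=> /andP[x0 x4]; exists (Num.truncn (4 / x)) => //=.
      rewrite in_itv/= x4 andbT /a ler_pdivrMr ?ltr_pwDl ?sqr_ge0//.
      rewrite mulrC -ler_pdivrMr//.
      have /andP[_ h] := truncn_itv (divr_ge0 (ler0n R 4) (ltW x0)).
      apply: (le_trans (ltW h)); rewrite ler_wpDl// expr2 ler_peMr// ler1n//.
    move=> [n _] /=; rewrite in_itv/= => /andP[ax ->]; rewrite andbT.
    exact: lt_le_trans ax.
  apply: ge0_nondecreasing_set_cvg_integral => //.
  - apply/nondecreasing_seqP => n; apply/subsetPset/subset_itvr.
    rewrite bnd_simp /a ler_wpM2l// lef_pV2 ?posrE ?ltr_pwDl ?sqr_ge0//.
    by rewrite lerD2l lerXn2r ?nnegrE// ler_nat.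
  - by move=> n; apply/measurable_EFinP; exact: mf.
  - move=> n x /=; rewrite in_itv/= => /andP[ax _]; rewrite lee_fin f0//.
    exact: lt_le_trans ax.
have L2 : (\int[leb]_(x in `[a n, 4%R]) (f x)%:E)%E
    @[n --> \oo] --> ((poisson_kappa z - 1) / 2)%:E.
  under eq_fun do rewrite step -EFinB.
  apply: cvg_EFin; first exact: nearW.
  have k0 := poisson_kappa_gt0 z0.
  have P4 : poisson_primitive z 4 = 0.
    by rewrite /poisson_primitive /vv subrr mul0r sqrtr0 mulr0 atan0 mulr0 subrr mulr0.
  have -> : (poisson_kappa z - 1) / 2 =
      0 - pi^-1 * (pi / 2 - poisson_kappa z * (pi / 2)).
    have := pi_gt0 R; move: (@pi R) => P P0; field; rewrite gt_eqF//.
  rewrite -P4; apply: cvgB; first exact: cvg_cst.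
  under eq_fun do rewrite /poisson_primitive va.
  apply: cvgM; first exact: cvg_cst.
  have cn : (n.+1%:R : R) @[n --> \oo] --> pinfty_nbhs R.
    apply/cvgryPge => A; near=> n; rewrite -natr1 ler_wpDr//.
    by near: n; exact: nbhs_infty_ger.
  apply: cvgB.
    apply: (@cvg_comp _ _ _ (fun n => n.+1%:R) (@atan R) _ (pinfty_nbhs R)) => //.
    exact: cvgy_atan.
  apply: cvgM; first exact: cvg_cst.
  apply: (@cvg_comp _ _ _ (fun n => (poisson_kappa z)^-1 * n.+1%:R) (@atan R)
    _ (pinfty_nbhs R)).
    apply: (@cvg_comp _ _ _ (fun n => n.+1%:R : R)
      (fun x => (poisson_kappa z)^-1 * x) _ (pinfty_nbhs R)) => //.
    by apply: gt0_cvgMry; [rewrite invr_gt0|exact: cvg_id].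
  exact: cvgy_atan.
rewrite integral_itv_bndo_bndc; last by apply/measurable_EFinP; exact: mf.
exact: cvg_unique L1 L2.
Unshelve. all: by end_near. Qed.

End FreePoisson.

(** * The Sigma-transform of the free Bessel laws *)

Section SigmaOfBessel.
Context {R : realType}.
Implicit Types (mu p : law R) (x y z v w r s : R).
Local Notation leb := (@lebesgue_measure R).
Local Notation nneg := (`[0%R, +oo[%classic : set (measurableTypeR R)).

(** The kernel is monotone; equality of two values forces x = 0 almost surely,
    since [1/(1-z'x) - 1/(1-zx)] is positive for x > 0. *)
Lemma eta_kernel_inj mu z z' : on_nneg_neq0 mu -> z < 0 -> z' < 0 ->
  eta_kernel mu z = eta_kernel mu z' -> z = z'.
Proof.
move=> [mu1 mu0]; wlog zz : z z' / z < z' => [H z0 z0' E|z0 z0' E].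
  case: (ltgtP z z') => // zz; first exact: H.
  by apply/esym; apply: H.
exfalso; apply: mu0.
have mneg : measurable nneg by [].
pose f x := (1 - z' * x)^-1 - (1 - z * x)^-1.
have f0 x : nneg x -> 0 <= f x /\ (f x = 0 -> x = 0).
  rewrite /= in_itv/= andbT => x0.
  have h : 0 < 1 - z * x by nra.
  have h' : 0 < 1 - z' * x by nra.
  have -> : f x = (z' - z) * x / ((1 - z' * x) * (1 - z * x)).
    by rewrite /f; field; rewrite !gt_eqF.
  split; first by rewrite divr_ge0 ?mulr_ge0// ?ltW// subr_gt0.
  move/eqP; rewrite !mulf_eq0 invr_eq0 mulf_eq0 !(gt_eqF h) !(gt_eqF h') subr_eq0 (gt_eqF zz)/= orbF.
  by move/eqP.
have i1 := integrable_eta_kernel mu (ltW z0).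
have i2 := integrable_eta_kernel mu (ltW z0').
have if0 : mu.-integrable nneg (EFin \o f).
  by have := integrableB mneg i2 i1; apply: eq_integrable => // x _; rewrite /= EFinB.
have mf := measurable_int _ if0.
have I0 : (\int[mu]_(x in nneg) `|(EFin \o f) x| = 0)%E.
  have -> : (\int[mu]_(x in nneg) `|(EFin \o f) x| = \int[mu]_(x in nneg) (f x)%:E)%E.
    by apply: eq_integral => x /set_mem xn /=; rewrite ger0_norm//; have [] := f0 x xn.
  rewrite -(fineK (integrable_fin_num mneg if0)).
  rewrite -/(Rintegral _ _ _) (RintegralB _ i2 i1)//.
  by move: E; rewrite /eta_kernel => ->; rewrite subrr.
have [N [mN N0 sN]] := (ae_eq_integral_abs mu mneg mf).1 I0.
have : mu (nneg `\ 0) = 0%E.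
  apply: (subset_measure0 _ mN) => //; first exact: measurableD.
  by move=> x [xn x0]; apply: sN => /= /(_ xn) [] /(f0 x xn).2.
move=> D0; have -> : [set 0] = nneg `\` (nneg `\ 0).
  apply/seteqP; split => [x ->|x [xn]]/=; first by rewrite in_itv/= lexx; split=> // -[].
  by move=> h; apply: contrapT => x0; apply: h.
rewrite measureD//=; last 2 first.
  - exact: measurableD.
  - by rewrite (le_lt_trans (probability_le1 _ _))// ltry.
rewrite setIidr; last exact: subDsetl.
by rewrite D0 sube0.
Qed.

(** A converse to [eta_kernel_Sigma], for computing Sigma-transforms. *)
Lemma Sigma_eta_kernel mu z w : on_nneg_neq0 mu -> z < 0 ->
  eta_kernel mu z = (1 - w)^-1 -> Sigma_transform mu w = z / w.
Proof.
move=> mu1 z0 E; rewrite /Sigma_transform; congr (_ / _).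
have mun : on_nneg mu by case: mu1.
have -> : w = eta_transform mu z.
  by rewrite eta_transformE// E invrK opprB addrC subrK.
apply: pinv_inj => // x y; rewrite !inE/= !in_itv/= => x0 y0.
rewrite !eta_transformE// => /addrI/oppr_inj/invr_inj.
exact: eta_kernel_inj.
Qed.

Lemma free_poisson_nneg p : is_free_poisson p -> on_nneg_neq0 p.
Proof.
move=> pP; split.
  rewrite /on_nneg -(@probability_setT _ _ _ p) !pP// setTI; congr (integral _ _ _).
  apply/seteqP; split=> [x []//|x /=]; rewrite !in_itv/= => /andP[x0 x4].
  by rewrite x4 x0 ltW.
rewrite pP//.
have -> : [set 0] `&` `]0%R, 4%R[ = set0 :> set R.
  by apply/seteqP; split=> [x [->]|x]//=; rewrite in_itv/= ltxx.
by rewrite integral_set0 => /eqP; rewrite eq_sym onee_eq0.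
Qed.

Lemma eta_kernel_free_poisson p w : is_free_poisson p -> w < 0 ->
  eta_kernel p (w * (1 - w)) = (1 - w)^-1.
Proof.
move=> pP w0; set z := w * (1 - w).
have z0 : z < 0 by rewrite /z; nra.
have zn : z != 0 by rewrite lt_eqF.
have [pn _] := free_poisson_nneg pP.
pose g x : \bar R := (`|1 - z * x|^-1)%:E.
have mg : measurable_fun setT (g : measurableTypeR R -> \bar R).
  apply/measurable_EFinP; apply: (measurableT_comp measurable_inv).
  apply: measurableT_comp => //.
  by apply: measurable_funB => //; exact: measurable_funM.
have -> : eta_kernel p z = fine (\int[p]_x g x)%E.
  rewrite (@integral_carrier _ p nneg)//; congr fine; apply: eq_integral => x /set_mem.
  rewrite /= in_itv/= andbT /g => x0; rewrite ger0_norm//; nra.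
rewrite (@integral_density R p `]0%R, 4%R[ (@free_poisson_density R))//; last first.
- by move=> x; rewrite lee_fin invr_ge0.
- by move=> x; rewrite /= in_itv/= => /andP[/ltW x0 _]; exact: free_poisson_density_ge0.
- by apply: measurable_funTS; exact: measurable_free_poisson_density.
have mk : measurable_fun (`]0%R, 4%R[%classic : set (measurableTypeR R))
    (fun x : measurableTypeR R => ((x - z^-1)^-1 * free_poisson_density x)%:E).
  apply/measurable_EFinP/measurable_funTS/measurable_funM.
    2: exact: measurable_free_poisson_density.
  by apply: (measurableT_comp measurable_inv); exact: measurable_funB.
have -> : (\int[leb]_(x in `]0%R, 4%R[) (g x * (free_poisson_density x)%:E) =
  (- z^-1)%:E * \int[leb]_(x in `]0%R, 4%R[)
    ((x - z^-1)^-1 * free_poisson_density x)%:E)%E.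
  rewrite -ge0_integralZl_EFin//.
  - apply: eq_integral => x /set_mem; rewrite /= in_itv/= => /andP[x0 _].
    rewrite /g -!EFinM; congr EFin; have zx : 0 < 1 - z * x by nra.
    rewrite gtr0_norm// [RHS]mulrA; congr (_ * free_poisson_density x).
    have xz : x - z^-1 != 0 by rewrite subr_eq0 gt_eqF// (lt_trans _ x0)// invr_lt0.
    have z1 : z * x - 1 != 0 by rewrite -opprB oppr_eq0 gt_eqF.
    have -> : 1 - z * x = - z * (x - z^-1) by field.
    by rewrite invfM invrN.
  - move=> x; rewrite /= in_itv/= => /andP[x0 _]; rewrite lee_fin mulr_ge0//.
      by rewrite invr_ge0 subr_ge0 (le_trans _ (ltW x0))// invr_le0 ltW.
    by rewrite free_poisson_density_ge0// ltW.
  - by rewrite oppr_ge0 invr_le0 ltW.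
rewrite integral_poisson_kernel ?invr_lt0// -EFinM/=.
have -> : poisson_kappa z^-1 = 1 - 2 * w.
  rewrite /poisson_kappa invrK.
  have -> : (z^-1 - 4) * z = (1 - 2 * w) ^+ 2.
    by rewrite mulrBl mulVf// /z; ring.
  by rewrite sqrtr_sqr ger0_norm//; lra.
have wn : w != 0 by rewrite lt_eqF.
have w1 : 1 - w != 0 by rewrite gt_eqF// subr_gt0; lra.
by rewrite /z; field; rewrite wn w1.
Qed.

Lemma Sigma_free_poisson p w : is_free_poisson p -> w < 0 ->
  Sigma_transform p w = 1 - w.
Proof.
move=> pP w0; rewrite (Sigma_eta_kernel (free_poisson_nneg pP) _ (eta_kernel_free_poisson pP w0)).
  by rewrite mulrC mulrA mulVf ?mul1r// lt_eqF.
by nra.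
Qed.

Lemma R_free_poisson p w : is_free_poisson p -> w < 0 ->
  R_transform p w = (1 - w)^-1.
Proof.
move=> pP w0; have [pn _] := free_poisson_nneg pP.
have G v : v < 0 -> Cauchy_transform p (v * (1 - v))^-1 = v.
  move=> v0; have z0 : v * (1 - v) < 0 by nra.
  rewrite Cauchy_eta_kernel// eta_kernel_free_poisson// mulfK//.
  by rewrite gt_eqF// subr_gt0; lra.
(* G is inverted by w |-> 1/(w(1-w)) *)
have Ginj : {in `]-oo, 0[%classic &, injective (Cauchy_transform p)}.
  have Ginv z : z < 0 -> z = (Cauchy_transform p z * (1 - Cauchy_transform p z))^-1.
    move=> z0; have k1 : 1 < poisson_kappa z.
      rewrite -[ltLHS]sqrtr1 ltr_sqrt; last first.
        by rewrite -[X in 0 < X]mulrNN -invrN mulr_gt0 ?invr_gt0 ?oppr_gt0//; lra.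
      by rewrite mulrBl divff ?lt_eqF// ltrDl oppr_gt0 pmulr_rlt0// invr_lt0.
    have zE : z = ((1 - poisson_kappa z) / 2 * (1 - (1 - poisson_kappa z) / 2))^-1.
      rewrite -[LHS]invrK; congr GRing.inv.
      have := poisson_kappa_sqr z0; move: (poisson_kappa z) => k kE.
      have -> : (1 - k) / 2 * (1 - (1 - k) / 2) = (1 - k ^+ 2) / 4 by field.
      by rewrite kE; field; rewrite lt_eqF.
    by rewrite [X in Cauchy_transform p X]zE G -?zE//; lra.
  move=> x y; rewrite !inE/= !in_itv/= => x0 y0 E.
  by rewrite (Ginv x)// E -Ginv.
rewrite /R_transform -[X in 'pinv__ _ _ X](G w)// pinv_inj//; last by rewrite invr_lt0; nra.
have wn : w != 0 by rewrite lt_eqF.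
have w1 : 1 - w != 0 by rewrite gt_eqF// subr_gt0; lra.
by field; rewrite wn w1.
Qed.

(** With w = v/(s-(s-1)v), the point 1/(v Sigma(v)) is where G takes the value
    w, by the linearization of the additive convolution by R. *)
Lemma Sigma_free_poisson_add_power p s p2 : 1 <= s -> is_free_poisson p ->
  is_free_add_power p s p2 -> on_nneg_neq0 p2 ->
  exists2 e, 0 < e & forall v, - e < v -> v < 0 ->
    Sigma_transform p2 v = (1 - v) / (s - (s - 1) * v).
Proof.
move=> s1 pP [_ p2n [e e0 HR]] p2P; exists e => // v ve v0.
pose d := s - (s - 1) * v; have d1 : 1 <= d by rewrite /d; nra.
have d0 : 0 < d by lra.
pose w := v / d.
have w0 : w < 0 by rewrite /w pmulr_llt0// invr_gt0.
have wv : v <= w.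
  by rewrite /w ler_pdivlMr//; nra.
have vn : v != 0 by rewrite lt_eqF.
have dn : d != 0 by rewrite gt_eqF.
have wn : w != 0 by rewrite lt_eqF.
have w1 : 1 - w != 0 by rewrite gt_eqF// subr_gt0; lra.
have := HR w; rewrite in_itv/= w0 (lt_le_trans ve wv) => /(_ isT).
rewrite (R_free_poisson pP w0) /R_transform => /eqP; rewrite subr_eq => /eqP KE.
have v1 : 1 - v != 0 by rewrite gt_eqF// subr_gt0; lra.
have sn : s != 0 by rewrite gt_eqF//; lra.
have z0 : v * (1 - v) / d < 0 by rewrite pmulr_llt0 ?invr_gt0//; nra.
have KE2 : s * (1 - w)^-1 + w^-1 = (v * (1 - v) / d)^-1.
  have -> : 1 - w = s * (1 - v) / d.
    by rewrite /w -[X in X - _](divff dn) -mulrBl; congr (_ / _); rewrite /d; ring.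
  by rewrite /w; field; rewrite vn v1 dn sn.
have [] := @pinv_neq0 R (Cauchy_transform p2) w.
  by rewrite KE KE2 invr_eq0 lt_eqF.
rewrite KE KE2 => _ GK.
rewrite (@Sigma_eta_kernel p2 (v * (1 - v) / d) v)//.
  by rewrite -/d; field; rewrite vn dn.
move: GK; rewrite Cauchy_eta_kernel// => GK.
apply: (mulfI (_ : v * (1 - v) / d != 0)); first by rewrite lt_eqF.
by rewrite GK /w; field; rewrite v1 dn.
Qed.

Lemma Sigma_free_bessel r s mu : is_free_bessel r s mu ->
  ((0 <= r /\ s = 1) \/ (1 <= r /\ 1 <= s)) /\
  \forall w \near (0:R)^'-, Sigma_transform mu w = bessel_Sigma r s w.
Proof.
case=> [p r0 -> pP [_ _ muS]|p p1 p2 r1 s1 pP [_ _ p1S] p2P [p1n p2n mun [c c0 muS]]].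
  split; first by left.
  near=> w; have w0 : w < 0 by near: w; exact: nbhs_left_lt.
  by rewrite muS// (Sigma_free_poisson pP)// /bessel_Sigma subrr mul0r subr0 divr1.
split; first by right.
have [e e0 p2S] := Sigma_free_poisson_add_power s1 pP p2P p2n.
near=> w; have w0 : w < 0 by near: w; exact: nbhs_left_lt.
have wc : - c < w by near: w; apply: nbhs_left_gt; rewrite oppr_lt0.
have we : - e < w by near: w; apply: nbhs_left_gt; rewrite oppr_lt0.
rewrite muS ?in_itv/= ?wc// p1S// (Sigma_free_poisson pP)// p2S// mulrA; congr (_ / _).
by rewrite -[X in _ * X]powRr1 -?gt0_powRD ?subrK// ?subr_ge0 ?subr_gt0; lra.
Unshelve. all: by end_near. Qed.

End SigmaOfBessel.

(** * Moments of the rescaled roots *)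

Section RootMoments.
Context {R : realType}.
Implicit Types (mu nu : law R) (t r s c p a : R).
Local Notation nneg := (`[0%R, +oo[%classic : set (measurableTypeR R)).
Local Notation pos := (`]0%R, +oo[%classic : set (measurableTypeR R)).

Lemma moments_free_bessel_power r s mu t nu k :
  is_free_bessel r s mu -> is_free_mul_power mu t nu -> (0 < k)%N ->
  (\int[nu]_(x in nneg) (x ^+ k)%:E = (bessel_moment r s t k)%:E)%E.
Proof.
move=> muP [_ nup nuS] k0; have [rs muS] := Sigma_free_bessel muP.
have nuS' : \forall w \near (0:R)^'-, Sigma_transform nu w = bessel_Sigma r s w `^ t /\
    0 < bessel_Sigma r s w `^ t.
  near=> w; have w0 : w < 0 by near: w; exact: nbhs_left_lt.
  split; last by rewrite powR_gt0// (bessel_Sigma_gt0 rs).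
  by rewrite nuS//; congr (_ `^ t); near: w; exact: muS.
have kk : (0 < k <= k)%N by rewrite k0 leqnn.
rewrite (moments_of_Sigma (on_pos_nneg nup) nuS' (expands_bessel rs t k.+1)
  (expands_bessel_inv rs t k.+1) kk).
have binom_poly_widen a c : eq_modXn k (binom_poly a c k.+1) (binom_poly a c k).
  by apply: coef_eq_modXn => i ik; rewrite !coef_poly ik ltnW.
congr (_ / _)%:E; apply: (@eq_modXn_coef _ k); last by rewrite prednK.
apply: eq_modXn_mul; first exact: eq_modXn_refl.
apply: eq_modXn_exp; rewrite /bessel_inv_poly -!mul_polyC.
apply: eq_modXn_mul; first exact: eq_modXn_refl.
by apply: eq_modXn_mul.
Unshelve. all: by end_near. Qed.

Lemma dilation_power_nneg c p mu : 0 <= c -> on_nneg (dilation c (law_power mu p)).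
Proof.
move=> c0; rewrite /on_nneg /= /pushforward /= -(@probability_setT _ _ _ mu); congr (mu _).
by apply/seteqP; split => // x _ /=; rewrite in_itv/= andbT mulr_ge0// powR_ge0.
Qed.

Lemma integral_dilation_power c p mu (f : R -> R) : 0 <= c -> on_pos mu ->
  measurable_fun setT (f : measurableTypeR R -> R) -> (forall y, 0 <= f y) ->
  (\int[dilation c (law_power mu p)]_(y in nneg) (f y)%:E =
   \int[mu]_(x in pos) (f (c * x `^ p))%:E)%E.
Proof.
move=> c0 mup mf f0.
have mF : measurable_fun setT (fun y : measurableTypeR R => (f y)%:E).
  exact/measurable_EFinP.
have mS : measurable_fun setT (scale_fun c) by exact: measurable_scale_fun.
have mP : measurable_fun setT (power_fun p) by exact: measurable_power_fun.
rewrite -(@integral_carrier _ (dilation c (law_power mu p)) nneg)//.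
  2: exact: dilation_power_nneg.
rewrite (ge0_integral_pushforward mS)// => [|y _]; last by rewrite lee_fin.
rewrite preimage_setT (ge0_integral_pushforward mP)//; last 2 first.
- exact: (measurableT_comp mF mS).
- by move=> y _; rewrite /= lee_fin.
rewrite preimage_setT (@integral_carrier _ mu pos)//.
apply: (measurableT_comp _ mP); exact: (measurableT_comp mF mS).
Qed.

(** [(t^r x^(1/t))^u = t^(ru) x^k] when u = kt. *)
Lemma root_moment r s mu t nu n : is_free_bessel r s mu -> is_free_mul_power mu t nu ->
  0 < t -> t < 1 -> (0 < n)%N ->
  (\int[dilation (t `^ r) (law_power nu t^-1)]_(y in nneg) (y `^ root_exponent n t)%:E =
   (t `^ (r * root_exponent n t) * bessel_moment r s t (root_index n t))%:E)%E.
Proof.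
move=> muP nuP t0 t1 n0; have [_ nup _] := nuP.
set k := root_index n t; have k0 : (0 < k)%N by exact: root_index_gt0.
rewrite integral_dilation_power ?powR_ge0//; last by move=> y; exact: powR_ge0.
rewrite EFinM -(moments_free_bessel_power muP nuP k0).
have mX : measurable_fun setT (fun x : measurableTypeR R => (x ^+ k)%:E).
  by apply/measurable_EFinP; exact: measurable_pow.
rewrite -(@integral_carrier _ nu nneg)//; last exact: on_pos_nneg.
rewrite (@integral_carrier _ nu pos)//.
rewrite -ge0_integralZl_EFin ?powR_ge0//; last 2 first.
- by move=> x /=; rewrite in_itv/= andbT => x0; rewrite lee_fin exprn_ge0// ltW.
- exact: measurable_funTS.
apply: eq_integral => x /set_mem; rewrite /= in_itv/= andbT => x0.
rewrite -EFinM; congr EFin.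
rewrite powRM ?powR_ge0// -!powRrM; congr (_ * _).
rewrite /root_exponent -/k mulrCA mulVf ?gt_eqF// mulr1 powR_mulrn// ltW//.
Qed.

(** The moment of order n is squeezed between those of order u <= n and
    v > n, both explicit: y^n >= y^u - (n/u - 1) and y^n <= y^u + 2t y^v, where
    (n-u)/(v-u) <= t/(1-t) <= 2t. *)
Lemma cvg_root_moments r s mu (nu : R -> law R) n : is_free_bessel r s mu ->
  (forall t, 0 < t -> is_free_mul_power mu t (nu t)) -> (0 < n)%N ->
  (\int[dilation (t `^ r) (law_power (nu t) t^-1)]_(x in nneg) (x ^+ n)%:E)%E
    @[t --> (0:R)^'+] --> ((n%:R : R) `^ (r * n%:R) / Gamma (2 + r * n%:R))%:E.
Proof.
move=> muP nuP n0; have [rs _] := Sigma_free_bessel muP.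
pose X t := dilation (t `^ r) (law_power (nu t) t^-1).
pose u (t : R) := root_exponent n t; pose v (t : R) := root_exponent n.+1 t.
pose h n (t : R) := t `^ (r * root_exponent n t) * bessel_moment r s t (root_index n t).
have n1 : 1 <= n%:R :> R by rewrite ler1n.
have ucvg : u t @[t --> (0:R)^'+] --> (n%:R : R) by exact: cvg_root_exponent.
have tcvg : t @[t --> (0:R)^'+] --> (0 : R) by apply: cvg_at_right_filter; exact: cvg_id.
apply: (@squeeze_cvge _ _ _ _ (fun t => (h n t - (n%:R / u t - 1))%:E) _
  (fun t => (h n t + 2 * t * h n.+1 t)%:E)).
- near=> t.
  have t0 : 0 < t by near: t; exact: nbhs_right_gt.
  have t2 : t < 1 / 2 by near: t; apply: nbhs_right_lt.
  have t1 : t < 1 by lra.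
  have /andP[un u_n] := root_exponent_bounds n t0; rewrite -/(u t) in un u_n.
  have /andP[vn v_n] := root_exponent_bounds n.+1 t0; rewrite -/(v t) -natr1 in vn v_n.
  have u0 : 0 < u t by lra.
  have mn : measurable nneg by [].
  have mp a : measurable_fun nneg (fun x : measurableTypeR R => (x `^ a)%:E).
    by apply/measurable_EFinP/measurable_funTS; exact: measurable_powR.
  have pn x : nneg x -> x ^+ n = x `^ n%:R.
    by rewrite /= in_itv/= andbT => x0; rewrite powR_mulrn.
  have -> : (\int[X t]_(x in nneg) (x ^+ n)%:E = \int[X t]_(x in nneg) (x `^ n%:R)%:E)%E.
    by apply: eq_integral => x /set_mem/pn ->.
  have p0 a x : (0 <= (x `^ a)%:E :> \bar R)%E by rewrite lee_fin powR_ge0.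
  have hn := root_moment muP (nuP t t0) t0 t1 n0.
  rewrite -/(h n t) -/(u t) -/(X t) in hn.
  have hv := root_moment muP (nuP t t0) t0 t1 (ltn0Sn n).
  rewrite -/(h n.+1 t) -/(v t) -/(X t) in hv.
  apply/andP; split.
    rewrite EFinB leeBlDr// -hn.
    have q0 : 0 <= n%:R / u t - 1 by rewrite subr_ge0 ler_pdivlMr// mul1r.
    have -> : ((n%:R / u t - 1)%:E = \int[X t]_(x in nneg) (n%:R / u t - 1)%:E)%E.
      rewrite integral_cst// [X in (_ * X)%E](_ : _ = 1%E) ?mule1//.
      exact/dilation_power_nneg/powR_ge0.
    rewrite -ge0_integralD//.
    apply: ge0_le_integral => //.
    + by apply: emeasurable_funD.
    + by move=> x _; rewrite -EFinD lee_fin power_lower.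
  have -> : (h n t + 2 * t * h n.+1 t)%:E =
    ((h n t)%:E + (2 * t)%:E * (h n.+1 t)%:E)%E by [].
  rewrite -hn -hv -ge0_integralZl_EFin//; last by lra.
  rewrite -ge0_integralD//; last 2 first.
    by move=> x _; rewrite -EFinM lee_fin mulr_ge0 ?powR_ge0//; lra.
    by apply: measurable_funeM.
  apply: ge0_le_integral => //.
  + by apply: emeasurable_funD => //; exact: measurable_funeM.
  + move=> x; rewrite /= in_itv/= andbT => x0; rewrite -EFinM -EFinD lee_fin.
    apply: (le_trans (@power_interpolation _ x n%:R (u t) (v t) _ _ _ _)) => //; first by lra.
    rewrite lerD2l ler_wpM2r ?powR_ge0// ler_pdivrMr; last by lra.
    by nra.
- apply: cvg_EFin; first exact: nearW.
  have -> : (n%:R : R) `^ (r * n%:R) / Gamma (2 + r * n%:R) =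
    (n%:R : R) `^ (r * n%:R) / Gamma (2 + r * n%:R) - (n%:R / (n%:R : R) - 1).
    by rewrite divff ?subrr ?subr0// pnatr_eq0 -lt0n.
  apply: cvgB; first exact: cvg_scaled_bessel_moment.
  apply: cvgB; last exact: cvg_cst.
  apply: cvgM; first exact: cvg_cst.
  by apply: cvgV => //; rewrite pnatr_eq0 -lt0n.
- apply: cvg_EFin; first exact: nearW.
  have -> : (n%:R : R) `^ (r * n%:R) / Gamma (2 + r * n%:R) =
    (n%:R : R) `^ (r * n%:R) / Gamma (2 + r * n%:R) +
    2 * 0 * ((n.+1%:R : R) `^ (r * n.+1%:R) / Gamma (2 + r * n.+1%:R)).
    by rewrite mulr0 mul0r addr0.
  apply: cvgD; first exact: cvg_scaled_bessel_moment.
  apply: cvgM; last exact: cvg_scaled_bessel_moment.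
  by apply: cvgM; [exact: cvg_cst|].
Unshelve. all: by end_near. Qed.

End RootMoments.

(** * Polynomial approximation *)

Section Bernstein.
Context {R : realType}.
Implicit Types (g h : nat -> R) (f : R -> R) (x : R).

(** The Bernstein polynomial as the expectation of g at a sum of n independent
    Bernoulli variables of parameter 'X, conditioning on the last one: with this
    form positivity and the moments are immediate inductions. *)
Fixpoint bernstein n g : {poly R} :=
  if n is m.+1 then
    (1 - 'X) * bernstein m g + 'X * bernstein m (fun k => g k.+1)
  else (g 0%N)%:P.

Lemma bernsteinS n g x : (bernstein n.+1 g).[x] =
  (1 - x) * (bernstein n g).[x] + x * (bernstein n (fun k => g k.+1)).[x].
Proof. by rewrite /= !hornerE. Qed.

Lemma bernstein_le n g h x : 0 <= x <= 1 -> (forall k, g k <= h k) ->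
  (bernstein n g).[x] <= (bernstein n h).[x].
Proof.
move=> x01; elim: n g h => [|n IH] g h gh; first by rewrite /= !hornerC.
by rewrite !bernsteinS lerD// ler_wpM2l ?IH//; case/andP: x01; rewrite ?subr_ge0.
Qed.

Lemma bernstein_affine n g x a b : (bernstein n (fun k => a * g k + b)).[x] =
  a * (bernstein n g).[x] + b.
Proof.
elim: n g => [|n IH] g; first by rewrite /= !hornerC.
by rewrite !bernsteinS !IH; ring.
Qed.

Lemma bernstein_second_moment n x a :
  (bernstein n (fun k => (k%:R - a) ^+ 2)).[x] =
  (n%:R * x - a) ^+ 2 + n%:R * (x * (1 - x)).
Proof.
elim: n a => [|n IH] a; first by rewrite /= !hornerC; ring.
rewrite bernsteinS IH.
have -> : (fun k => (k.+1%:R - a) ^+ 2) = (fun k => (k%:R - (a - 1)) ^+ 2).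
  by apply/funext => k; rewrite -natr1; ring.
by rewrite IH -natr1; ring.
Qed.

Lemma uniform_continuity_segment f (a b e : R) : continuous f -> 0 < e ->
  exists2 d, 0 < d & forall x y, a <= x <= b -> `|y - x| < d -> `|f y - f x| <= e.
Proof.
move=> cf e0; have := @segment_compact R a b => /compact_near_coveringP H.
have := H R (0:R)^'+ (fun d x => forall y, `|y - x| < d -> `|f y - f x| <= e) _.
case.
- move=> x _.
  have /cvgrPdist_lt/(_ (e / 2)) := cf x.
  rewrite divr_gt0// => /(_ isT)/nbhs_ballP[d /= d0 Hd].
  near=> x' d' => /= y yx'.
  have x'x : `|x - x'| < d / 2.
    near: x'; apply/nbhs_ballP; exists (d / 2) => //=; rewrite divr_gt0//.
  have dd : d' < d / 2.
    by near: d'; apply: nbhs_right_lt; rewrite divr_gt0.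
  have h1 : `|f x - f x'| < e / 2 by apply: Hd; rewrite /ball/= (lt_trans x'x)//; lra.
  have h2 : `|f x - f y| < e / 2.
    apply: Hd; rewrite /ball/= -(subrK x' x) -addrA (le_lt_trans (ler_normD _ _))//.
    by rewrite (distrC x' y); lra.
  rewrite -(subrK (f x) (f y)) -addrA (le_trans (ler_normD _ _))// distrC.
  by lra.
- move=> d /= d0 Hd; exists (d / 2); first by rewrite divr_gt0.
  move=> x y xab; apply: Hd => //=; rewrite ?in_itv//=.
    by rewrite sub0r normrN gtr0_norm ?divr_gt0//; lra.
  by rewrite divr_gt0.
Unshelve. all: by end_near. Qed.

(** Bernstein: [|f(x) - f(k/n)|] is at most e/2 when k/n is near x, and the
    other k are controlled by the variance, through the bound by
    [c (x - k/n)^2].  As [bernstein_le] compares values at all natural numbers,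
    the nodes are truncated at 1. *)
Lemma Weierstrass_unit f (e : R) : continuous f -> 0 < e ->
  exists p : {poly R}, forall x, 0 <= x <= 1 -> `|f x - p.[x]| <= e.
Proof.
move=> cf e0.
have [C C0 fC] : exists2 C, 0 < C & forall x, 0 <= x <= 1 -> `|f x| <= C.
  have [M [Mr HM]] := compact_bounded (continuous_compact
    (continuous_subspaceT cf) (@segment_compact R 0 1)).
  exists (`|M| + 1); first by rewrite ltr_pwDr.
  move=> x x01; apply: (HM (`|M| + 1)); first by rewrite ltr_pwDr// ler_norm.
  by exists x => //=; rewrite in_itv.
have e20 : 0 < e / 2 by rewrite divr_gt0.
have [d d0 Hd] := @uniform_continuity_segment f 0 1 (e / 2) cf e20.
pose c := 2 * C / d ^+ 2; have c0 : 0 < c by rewrite divr_gt0 ?mulr_gt0 ?exprn_gt0.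
pose n := (Num.truncn (c / (e / 2))).+1.
have n0 : 0 < n%:R :> R by rewrite ltr0n.
exists (bernstein n (fun k => f (Num.min 1 (k%:R / n%:R)))) => x x01.
have node k : `|f x - f (Num.min 1 (k%:R / n%:R))| <= e / 2 + c * (x - k%:R / n%:R) ^+ 2.
  set y := Num.min _ _; have y01 : 0 <= y <= 1.
    by rewrite /y ge_min lexx le_min ler01 divr_ge0.
  have yx : `|y - x| <= `|x - k%:R / n%:R|.
    rewrite /y; case: (leP 1 (k%:R / n%:R)) => h; last by rewrite distrC.
    by rewrite ger0_norm ?subr_ge0; [rewrite ler0_norm; lra|lra].
  have [xd|xd] := ltP `|y - x| d.
    by rewrite distrC ler_wpDr ?Hd// mulr_ge0 ?sqr_ge0// ltW.
  apply: ler_wpDl; first exact: ltW.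
  apply: (@le_trans _ _ (2 * C)).
    by rewrite (le_trans (ler_normB _ _))// mulr_natl mulr2n lerD ?fC.
  rewrite /c mulrAC ler_pdivlMr ?exprn_gt0// ler_wpM2l ?mulr_ge0 ?(ltW C0)//.
  rewrite -(real_normK (num_real (x - _))) lerXn2r ?nnegrE ?(ltW d0)//.
  exact: le_trans yx.
pose q k := (c / n%:R ^+ 2) * (k%:R - n%:R * x) ^+ 2 + e / 2.
have mom : (bernstein n q).[x] <= e.
  rewrite bernstein_affine bernstein_second_moment subrr expr0n/= add0r.
  rewrite -lerBrDr (_ : e - e / 2 = e / 2); last by field.
  have -> : c / n%:R ^+ 2 * (n%:R * (x * (1 - x))) = c / n%:R * (x * (1 - x)).
    by field; rewrite gt_eqF.
  apply: (@le_trans _ _ (c / n%:R)).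
    by rewrite ler_piMr ?divr_ge0 ?ltW//; nra.
  rewrite ler_pdivrMr// mulrC -ler_pdivrMr//.
  by have /andP[_ /ltW] := truncn_itv (ltW (divr_gt0 c0 e20)).
have {}node k : `|f x - f (Num.min 1 (k%:R / n%:R))| <= q k.
  apply: (le_trans (node k)); rewrite le_eqVlt; apply/orP; left; apply/eqP.
  by rewrite /q; field; rewrite gt_eqF.
rewrite ler_distlC; apply/andP; split.
  apply: (le_trans _ (@bernstein_le n (fun k => -1 * q k + f x) _ x x01 _)).
    by rewrite bernstein_affine; lra.
  by move=> k; have := node k; rewrite ler_norml => /andP[]; lra.
apply: (le_trans (@bernstein_le n _ (fun k => 1 * q k + f x) x x01 _)).
  by move=> k; have := node k; rewrite ler_norml => /andP[]; lra.
by rewrite bernstein_affine; lra.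
Unshelve. all: by end_near. Qed.

Lemma Weierstrass_segment f (L e : R) : continuous f -> 0 < L -> 0 < e ->
  exists p : {poly R}, forall x, 0 <= x <= L -> `|f x - p.[x]| <= e.
Proof.
move=> cf L0 e0; have [||p Hp] := @Weierstrass_unit (fun y => f (L * y)) e => //.
  move=> x; apply: (@continuous_comp _ _ _ (fun y => L * y) f); last exact: cf.
  by apply: cvgM; [exact: cvg_cst|exact: cvg_id].
exists (p \Po (L^-1 *: 'X)) => x /andP[x0 xL].
rewrite horner_comp hornerZ hornerX -{1}[x](mulVKf (lt0r_neq0 L0)).
by apply: Hp; rewrite mulr_ge0 ?invr_ge0 ?(ltW L0)//= mulrC ler_pdivrMr// mul1r.
Qed.

Lemma horner_growth (p : {poly R}) (L x : R) N : 0 < L -> L <= x -> (size p <= N)%N ->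
  `|p.[x]| <= (\sum_(i < size p) `|p`_i| * L ^+ i) * (x / L) ^+ N.
Proof.
move=> L0 Lx pN; rewrite horner_coef (le_trans (ler_norm_sum _ _ _))// mulr_suml.
apply: ler_sum => i _; rewrite normrM -mulrA ler_wpM2l// normrX.
have x1 : 1 <= x / L by rewrite ler_pdivlMr// mul1r.
rewrite ger0_norm; last by lra.
rewrite -{1}[x](divfK (lt0r_neq0 L0)) exprMn mulrC ler_wpM2l ?exprn_ge0// ?(ltW L0)//.
by rewrite ler_weXn2l// (leq_trans _ pN)// ltnW.
Qed.

End Bernstein.

(** * The method of moments *)

Section MomentMethod.
Context {R : realType}.
Implicit Types (mu nu : law R) (f : R -> R) (x : R).
Local Notation nneg := (`[0%R, +oo[%classic : set (measurableTypeR R)).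

Lemma integral_approx_moments nu f (p : {poly R}) (C e D L : R) N (c : nat -> R) :
  on_nneg nu -> measurable_fun setT (f : measurableTypeR R -> R) -> (forall x, `|f x| <= C) ->
  (size p <= N)%N ->
  (forall x, 0 <= x -> `|f x - p.[x]| <= e + D * (x / L) ^+ N) ->
  (forall n, (n <= N)%N -> (\int[nu]_(x in nneg) (x ^+ n)%:E = (c n)%:E)%E) ->
  `|\int[nu]_x f x - \sum_(i < size p) p`_i * c i| <= e + D / L ^+ N * c N.
Proof.
move=> nu1 mf fC pN fp cE; have mneg : measurable nneg by [].
have -> : \int[nu]_x f x = \int[nu]_(x in nneg) f x.
  by rewrite /Rintegral (@integral_carrier _ nu nneg)//; exact/measurable_EFinP.
have [I1 E1] := @Rintegral_moment_sum R nu (size p) c (fun j => p`_j)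
  (fun j jp => cE j (ltnW (leq_trans jp pN))).
have I0 : nu.-integrable nneg (EFin \o f).
  by apply: (@integrable_bounded _ _ _ _ C) => //; exact: measurable_funTS.
have IB := integrableB mneg I0 I1.
have IX : nu.-integrable nneg (EFin \o (fun x : R => x ^+ N)).
  by apply: (@integrable_pow _ _ _ (c N)); exact: cE.
have IZ : nu.-integrable nneg (EFin \o (fun x : R => D / L ^+ N * x ^+ N)).
  exact: (integrableZl (D := nneg) _ (D / L ^+ N) IX).
have IC : nu.-integrable nneg (EFin \o (fun x : R => e)).
  exact: (@integrable_bounded _ _ _ _ `|e|).
rewrite -E1 -RintegralB//.
apply: (le_trans (le_normr_Rintegral mneg IB)).
have -> : e + D / L ^+ N * c N = \int[nu]_(x in nneg) (e + D / L ^+ N * x ^+ N).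
  rewrite RintegralD// RintegralZl// Rintegral_cst// [X in fine X](_ : _ = 1%E)// mulr1.
  congr (_ + _ * _).
  by rewrite /Rintegral cE.
apply: le_Rintegral => //.
- have := integrable_norm IB; apply: eq_integrable => //.
- exact: (integrableD _ IC IZ).
- move=> x; rewrite /= in_itv/= andbT => x0.
  have := fp x x0; rewrite exprMn exprVn horner_coef mulrCA [in X in _ <= X]mulrC -mulrA.
  exact: le_trans.
Qed.

Lemma moment_le_pow mu (M : R) N c : 0 <= M -> mu `[0, M]%classic = 1%E ->
  (\int[mu]_(x in nneg) (x ^+ N)%:E = c%:E)%E -> c <= M ^+ N.
Proof.
move=> M0 mu1 cE; rewrite -lee_fin -cE.
have mn := on_segment_nneg mu1.
have mX : measurable_fun setT (fun x : measurableTypeR R => (x ^+ N)%:E).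
  by apply/measurable_EFinP; exact: measurable_pow.
rewrite -(@integral_carrier _ mu nneg)// (@integral_carrier _ mu `[0, M]%classic)//.
have H : (\int[mu]_(x in `[0%R, M]) (x ^+ N)%:E <=
    \int[mu]_(x in `[0%R, M]) (cst (M ^+ N)%:E x))%E.
  apply: ge0_le_integral => //.
  - by move=> x /=; rewrite in_itv/= => /andP[x0 _]; rewrite lee_fin exprn_ge0.
  - exact: measurable_funTS.
  - by move=> x /=; rewrite in_itv/= => /andP[x0 xM]; rewrite lee_fin lerXn2r.
apply: (le_trans H); rewrite integral_cst// [X in (_ * X)%E](_ : _ = 1%E)// mule1//.
Qed.

(** Let the limit be carried by [0,M].  A polynomial p close to f on [0,M+1]
    differs from f by at most [e + D (x/(M+1))^N] on the whole half-line, for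
    every N at least its size.  The integral of the last term tends to
    [D m_N/(M+1)^N <= D (M/(M+1))^N], which is small for N large. *)
Lemma weakly_cvg_of_moments {T : Type} (F : set_system T) {FF : ProperFilter F}
    (nu : T -> law R) mu (M : R) (m : nat -> R) :
  (\forall t \near F, on_nneg (nu t)) -> mu `[0, M]%classic = 1%E ->
  (forall n, (\int[nu t]_(x in nneg) (x ^+ n)%:E)%E @[t --> F] --> (m n)%:E) ->
  (forall n, (\int[mu]_(x in nneg) (x ^+ n)%:E = (m n)%:E)%E) ->
  weakly_cvg F nu mu.
Proof.
move=> nun; wlog M0 : M / 0 < M => [H muM|muM nuE muE].
  apply: (H (`|M| + 1)); first by rewrite ltr_pwDr.
  apply: probability_eq1_subset muM => //; apply: subset_itvl; rewrite bnd_simp.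
  by rewrite (le_trans (ler_norm M))// lerDl.
move=> f cf [C' [_ HC']].
pose C := `|C'| + 1; have C0 : 0 < C by rewrite /C ltr_pwDr.
have fC x : `|f x| <= C.
  by apply: (HC' C) => //; rewrite /C (le_lt_trans (ler_norm _))// ltrDl.
have mf : measurable_fun setT (f : measurableTypeR R -> R) by exact: continuous_measurable_fun.
have mun := on_segment_nneg muM.
apply/cvgrPdist_le => eps eps0.
pose e := eps / 6; have e0 : 0 < e by rewrite divr_gt0.
pose L := M + 1; have L0 : 0 < L by rewrite addr_gt0.
have [p Hp] := Weierstrass_segment cf L0 e0.
pose D := C + \sum_(i < size p) `|p`_i| * L ^+ i.
have D0 : 0 < D.
  rewrite ltr_pwDl// sumr_ge0// => i _.
  by rewrite mulr_ge0 ?exprn_ge0// ltW.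
have approx N x : (size p <= N)%N -> 0 <= x -> `|f x - p.[x]| <= e + D * (x / L) ^+ N.
  move=> pN x0; have xL0 : 0 <= x / L by rewrite divr_ge0// ltW.
  have [xL|Lx] := leP x L.
    apply: ler_wpDr; first by rewrite mulr_ge0 ?exprn_ge0// ltW.
    by apply: Hp; rewrite x0.
  apply: ler_wpDl; first exact: ltW.
  rewrite (le_trans (ler_normB _ _))// mulrDl lerD//.
    apply: (le_trans (fC x)); rewrite ler_peMr ?(ltW C0)// exprn_ege1//.
    by rewrite ler_pdivlMr// mul1r ltW.
  by apply: horner_growth => //; exact: ltW.
have [N [pN DN]] : exists N, (size p <= N)%N /\ D * (M / L) ^+ N <= e.
  have ML : `|M / L| < 1.
    by rewrite ger0_norm ?divr_ge0 ?ltW// ltr_pdivrMr// mul1r ltrDl.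
  have cN : D * (M / L) ^+ N @[N --> \oo] --> 0.
    by rewrite -(mulr0 D); apply: cvgM; [exact: cvg_cst|exact: cvg_expr].
  have /cvgrPdist_le/(_ e e0) h := cN.
  near \oo => N; exists N; split; first by near: N; exact: nbhs_infty_ge.
  have : `|0 - D * (M / L) ^+ N| <= e by near: N.
  by rewrite sub0r normrN; apply: le_trans; exact: ler_norm.
pose c t n := fine (\int[nu t]_(x in nneg) (x ^+ n)%:E)%E.
have cc n : c t n @[t --> F] --> m n by have /fine_cvgP[] := nuE n.
have fin : \forall t \near F, forall n, (n <= N)%N ->
    (\int[nu t]_(x in nneg) (x ^+ n)%:E = (c t n)%:E)%E.
  have : \forall t \near F, forall i : 'I_N.+1,
      (\int[nu t]_(x in nneg) (x ^+ i)%:E)%E \is a fin_num.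
    by apply: filter_forall => i; have /fine_cvgP[] := nuE i.
  by apply: filterS => t H n nN; rewrite /c fineK//; exact: (H (Ordinal (nN : (n < N.+1)%N))).
have sumc : \sum_(i < size p) p`_i * c t i @[t --> F] --> \sum_(i < size p) p`_i * m i.
  apply: (@cvg_big _ _ +%R) => [|i _]; first exact: add_continuous.
  by apply: cvgM; [exact: cvg_cst|exact: cc].
have lastc : D / L ^+ N * c t N @[t --> F] --> D / L ^+ N * m N.
  by apply: cvgM; [exact: cvg_cst|exact: cc].
have /cvgrPdist_le/(_ e e0) sumc' := sumc; have /cvgrPdist_le/(_ e e0) lastc' := lastc.
have lastm : D / L ^+ N * m N <= e.
  apply: (le_trans _ DN); rewrite exprMn exprVn [M ^+ N * _]mulrC mulrA ler_wpM2l//.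
    by rewrite divr_ge0 ?exprn_ge0// ltW.
  exact: moment_le_pow (ltW M0) muM (muE N).
near=> t.
have H1 := integral_approx_moments mun mf fC pN (fun x => approx N x pN)
  (fun n _ => muE n).
have H2 : `|\int[nu t]_x f x - \sum_(i < size p) p`_i * c t i| <= e + D / L ^+ N * c t N.
  apply: (integral_approx_moments _ mf fC pN (fun x => approx N x pN)); by near: t.
have H3 : `|\sum_(i < size p) p`_i * m i - \sum_(i < size p) p`_i * c t i| <= e.
  by near: t; exact: sumc'.
have H4 : `|D / L ^+ N * m N - D / L ^+ N * c t N| <= e.
  by near: t; exact: lastc'.
move: H1 H2 H3 H4 lastm; rewrite -/(e); have : eps = 6 * e by rewrite /e; field.
move=> ->.
move: (\int[mu]_x f x) (\int[nu t]_x f x) (\sum_(i < _) _ * m i) (\sum_(i < _) _ * c t i)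
  (D / L ^+ N * m N) (D / L ^+ N * c t N) => a b s s' d d'.
by rewrite !ler_norml => /andP[? ?] /andP[? ?] /andP[? ?] /andP[? ?] ?; apply/andP; split; lra.
Unshelve. all: by end_near. Qed.

End MomentMethod.

(** * Convergence to the Dykema-Haagerup law *)

Theorem theorem4p9 (R : realType) (r s : R)
    (rs_range : (0 <= r /\ s = 1) \/ (1 <= r /\ 1 < s))
    (mu : law R) (mu_bessel : is_free_bessel r s mu)
    (mu_pow : R -> law R)
    (mu_powP : forall t : R, 0 < t -> is_free_mul_power mu t (mu_pow t))
    (DH : law R) (DH_DykemaHaagerup : is_Dykema_Haagerup r DH) :
  weakly_cvg 0^'+ (fun t : R => dilation (t `^ r) (law_power (mu_pow t) t^-1))
    DH.
Proof.
have [[M DHM] DHE] := DH_DykemaHaagerup.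
have DHn := on_segment_nneg DHM.
apply: (@weakly_cvg_of_moments R _ _ _ _ _ M
  (fun n => n%:R `^ (r * n%:R) / Gamma (2 + r * n%:R))).
- by apply: nearW => t; apply: dilation_power_nneg; exact: powR_ge0.
- exact: DHM.
- move=> [|n]; last exact: cvg_root_moments mu_bessel mu_powP _.
  (* the case n = 0, which Lagrange inversion does not reach: both sides are
     total masses *)
  have mass (nu : law R) (D : set (measurableTypeR R)) : measurable D -> nu D = 1%E ->
      (\int[nu]_(x in D) (x ^+ 0)%:E = 1)%E.
    move=> mD nuD; under eq_integral do rewrite expr0.
    by rewrite integral_cst// [X in (_ * X)%E](_ : _ = 1%E) ?mule1.
  rewrite -DHE (mass DH)//; last exact: probability_setT.
  apply: cvg_near_cst; apply: nearW => t; apply: mass => //.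
  exact/dilation_power_nneg/powR_ge0.
- move=> n; rewrite -DHE; apply/esym/integral_carrier => //.
  by apply/measurable_EFinP; exact: measurable_pow.
Qed.
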